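(* Let $G$ be a finite group, $H=\mathbb{C}[G]$, and let $\mathcal{C}=\{t,x,y,z\}\subset G$ be a cyclic conjugacy class with $4$ elements. Then the Woronowicz exterior algebra $\Omega(H)=\bigoplus_m\Omega^m(H)$ associated to $\mathcal{C}$ has dimensions (ranks over $H$) in degrees $0,1,\dots,9$ equal to $$1:4:8:11:12:12:11:8:4:1,$$ and the top-form has degree $9$ (i.e. $\Omega^m(H)=0$ for $m>9$). Moreover this algebra is not quadratic: it has additional relations (relations that are not consequences of the relations in degree 2) in degree $\ge 6$.
   Context: Cyclic: a conjugacy class $\mathcal{C}$ with $n\ge 2$ elements in a group $G$ is called cyclic if there exists at least one $t\in\mathcal{C}$ such that $\mathrm{Ad}_t$ (where $\mathrm{Ad}_a(b)=aba^{-1}$) is a cyclic permutation of $\mathcal{C}-\{t\}$ (a single cycle on this set) and the map $a\mapsto \mathrm{Ad}_a(t)$ is a permutation of $\mathcal{C}$. Exterior algebra: $H=\mathbb{C}[G]$ is the algebra of complex functions on $G$, and $(R_af)(g)=f(ga)$. $\Omega^0(H)=H$, and $\Omega^1(H)$ is the free left $H$-module with basis $\{e_a\}_{a\in\mathcal{C}}$, with right module structure $e_af=R_a(f)e_a$. Let $\Psi$ be the $H$-bimodule map on $\Omega^1(H)\otimes_H\Omega^1(H)$ with $\Psi(e_a\otimes_H e_b)=e_{aba^{-1}}\otimes_H e_a$, and let $\Psi_{i,i+1}$ denote $\Psi$ acting in the $i$-th and $(i+1)$-th places of $\Omega^1(H)^{\otimes_H m}$. Define $[1,-\Psi]=\mathrm{id}$,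 $$[m,-\Psi]=\mathrm{id}-\Psi_{12}+\Psi_{12}\Psi_{23}-\cdots+(-1)^{m-1}\Psi_{12}\Psi_{23}\cdots\Psi_{m-1,m},$$ and the antisymmetrizers $$A_m=(\mathrm{id}^{\otimes(m-2)}\otimes[2,-\Psi])(\mathrm{id}^{\otimes(m-3)}\otimes[3,-\Psi])\cdots(\mathrm{id}\otimes[m-1,-\Psi])\,[m,-\Psi].$$ Then $\Omega^m(H)=\Omega^1(H)^{\otimes_H m}/\ker A_m$ for $m\ge2$, and the product $\wedge$ is induced by the tensor product over $H$. It is quadratic if all its relations are generated by the degree 2 relations $\ker A_2=\ker(\mathrm{id}-\Psi)$. Dimension in degree $m$ means the rank of $\Omega^m(H)$ as a free left $H$-module. *)

(* Defs.v *)
From HB Require Import structures.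
From mathcomp Require Import all_boot all_order all_fingroup all_algebra.
From mathcomp Require Import generic_quotient ring_quotient.
From mathcomp Require Import reals.
From mathcomp Require Export complex.

Set Implicit Arguments.
Unset Strict Implicit.
Unset Printing Implicit Defensive.

Import GroupScope GRing.Theory.
Local Open Scope ring_scope.
Local Open Scope quotient_scope.

(* The adjoint action a b a^-1; mathcomp's b ^ a is a^-1 b a. *)
Definition Ad (G : finGroupType) (a b : G) : G := (a * b * a^-1)%g.

Definition conj_class (G : finGroupType) (c : G) : {set G} := (c ^: [set: G])%g.

Definition cyclic_class (G : finGroupType) (C : {set G}) : Prop :=
  (2 <= #|C|)%N /\
  exists2 t : G, t \in C &
    (exists2 s : seq G, ufcycle (Ad t) s & s =i C :\ t) /\
    {in C &, injective (fun a => Ad a t)} /\ [set Ad a t | a in C] = C.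

Definition free_of_rank (A : pzRingType) (M : lmodType A) (d : nat) : Prop :=
  exists b : 'I_d -> M,
    forall u : M, exists! h : {ffun 'I_d -> A}, u = \sum_(i < d) h i *: b i.

Section WoronowiczAlgebra.
Variables (F : fieldType) (G : finGroupType) (c : G).

Local Notation H := {ffun G -> F}.

Definition rtrans (a : G) (f : H) : H := [ffun g => f (g * a)%g].

Definition class_elt : Type := {a : G | a \in conj_class c}.

HB.instance Definition _ := Finite.on class_elt.

Lemma Ad_class (a b : class_elt) : Ad (val a) (val b) \in conj_class c.
Proof.
rewrite /Ad /conj_class; case: b => b /= bC; move: bC.
case/imsetP=> g _ ->; apply/imsetP.
by exists (g * (val a)^-1)%g; rewrite ?inE // conjgM /conjg invgK !mulgA.
Qed.

Definition ad (a b : class_elt) : class_elt := Sub (Ad (val a) (val b)) (Ad_class a b).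

Local Notation word m := (m.-tuple class_elt).

(* The m-th tensor power of Omega^1(H) over H.  Moving all coefficients to the
   left with e_a f = R_a(f) e_a, it is the free left H-module on the words
   e_(a1) (x) ... (x) e_(am).  That [tensp p q] is indeed a tensor product
   over H of bimodules is [tensp_balanced] and [tensp_universal] below. *)
Definition tpow (m : nat) : Type := {ffun word m -> H^o}.

HB.instance Definition _ m := GRing.Lmodule.on (tpow m).

Definition tbasis m (w : word m) : tpow m := [ffun v => (v == w)%:R].

Definition wprod m (w : word m) : G := (\prod_(a <- w) val a)%g.

(* e_(a1) ... e_(am) f = R_(a1)(...(R_(am) f)) e_(a1) ... e_(am), and
   R_a \o R_b = R_(ab). *)
Definition ract m (u : tpow m) (f : H) : tpow m :=
  [ffun w => u w * rtrans (wprod w) f].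

Definition tensp p q (u : tpow p) (v : tpow q) : tpow (p + q) :=
  \sum_(a : word p) \sum_(b : word q)
    (u a * rtrans (wprod a) (v b)) *: tbasis (cat_tuple a b).

Lemma tpowE m (u : tpow m) : u = \sum_(w : word m) u w *: tbasis w.
Proof.
apply/ffunP=> w; rewrite sum_ffunE (bigD1 w) //= big1 ?addr0.
  by rewrite !ffunE eqxx [RHS]mulr1.
by move=> v vw; rewrite !ffunE eq_sym (negPf vw) [LHS]mulr0.
Qed.

Lemma rtransD a : {morph rtrans a : f g / f + g}.
Proof. by move=> f g; apply/ffunP=> x; rewrite !ffunE. Qed.

Lemma rtransM a : {morph rtrans a : f g / f * g}.
Proof. by move=> f g; apply/ffunP=> x; rewrite !ffunE. Qed.

Lemma rtrans1 a : rtrans a 1 = 1.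
Proof. by apply/ffunP=> x; rewrite !ffunE. Qed.

Lemma rtrans0 a : rtrans a 0 = 0.
Proof. by apply/ffunP=> x; rewrite !ffunE. Qed.

Lemma rtrans_comp a b f : rtrans a (rtrans b f) = rtrans (a * b)%g f.
Proof. by apply/ffunP=> x; rewrite !ffunE mulgA. Qed.

Lemma wprod_cat p q (a : word p) (b : word q) :
  wprod (cat_tuple a b) = (wprod a * wprod b)%g.
Proof. exact: big_cat. Qed.

Lemma ractA m (u : tpow m) f g : ract (ract u f) g = ract u (f * g).
Proof. by apply/ffunP=> w; rewrite !ffunE rtransM mulrA. Qed.

Lemma ract1 m (u : tpow m) : ract u 1 = u.
Proof. by apply/ffunP=> w; rewrite !ffunE rtrans1 mulr1. Qed.

Lemma ractDl m f : {morph (@ract m)^~ f : u v / u + v}.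
Proof. by move=> u v; apply/ffunP=> w; rewrite !ffunE mulrDl. Qed.

Lemma ractDr m (u : tpow m) : {morph ract u : f g / f + g}.
Proof. by move=> f g; apply/ffunP=> w; rewrite !ffunE rtransD mulrDr. Qed.

Lemma ractZ m h (u : tpow m) f : ract (h *: u) f = h *: ract u f.
Proof. by apply/ffunP=> w; rewrite !ffunE -[LHS]mulrA. Qed.

Lemma ract_tbasis m (w : word m) f :
  ract (tbasis w) f = rtrans (wprod w) f *: tbasis w.
Proof.
apply/ffunP=> v; rewrite !ffunE; case: eqP => [->|_].
  by rewrite mul1r [RHS]mulr1.
by rewrite mul0r [RHS]mulr0.
Qed.

Lemma tensp_Dl p q (v : tpow q) : {morph (@tensp p q)^~ v : u u' / u + u'}.
Proof.
move=> u u'; rewrite -big_split; apply: eq_bigr => a _; rewrite -big_split.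
by apply: eq_bigr => b _; rewrite !ffunE mulrDl scalerDl.
Qed.

Lemma tensp_Dr p q (u : tpow p) : {morph @tensp p q u : v v' / v + v'}.
Proof.
move=> v v'; rewrite -big_split; apply: eq_bigr => a _; rewrite -big_split.
by apply: eq_bigr => b _; rewrite !ffunE rtransD mulrDr scalerDl.
Qed.

Lemma tensp_Zl p q h (u : tpow p) (v : tpow q) :
  tensp (h *: u) v = h *: tensp u v.
Proof.
rewrite scaler_sumr; apply: eq_bigr => a _; rewrite scaler_sumr.
by apply: eq_bigr => b _; rewrite !ffunE scalerA mulrA.
Qed.

Lemma tensp_balanced p q (u : tpow p) f (v : tpow q) :
  tensp (ract u f) v = tensp u (f *: v).
Proof.
apply: eq_bigr => a _; apply: eq_bigr => b _.
by rewrite !ffunE -mulrA -rtransM.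
Qed.

Lemma tensp_tbasis p q (a : word p) (b : word q) :
  tensp (tbasis a) (tbasis b) = tbasis (cat_tuple a b).
Proof.
rewrite /tensp (bigD1 a) //= [X in _ + X]big1 ?addr0; last first.
  move=> a' a'a; rewrite big1 // => b' _.
  by rewrite !ffunE (negPf a'a) mul0r scale0r.
rewrite (bigD1 b) //= [X in _ + X]big1 ?addr0; last first.
  by move=> b' b'b; rewrite !ffunE (negPf b'b) rtrans0 mulr0 scale0r.
by rewrite !ffunE !eqxx rtrans1 mulr1 scale1r.
Qed.

Lemma tensp_ractr p q (u : tpow p) (v : tpow q) f :
  tensp u (ract v f) = ract (tensp u v) f.
Proof.
have r0 : ract (0 : tpow (p + q)) f = 0.
  by apply/ffunP=> w; rewrite !ffunE mul0r.
rewrite {2}/tensp (big_morph _ (@ractDl (p + q) f) r0); apply: eq_bigr => a _.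
rewrite (big_morph _ (@ractDl (p + q) f) r0).
apply: eq_bigr => b _; rewrite ractZ ract_tbasis wprod_cat scalerA !ffunE.
by rewrite rtransM rtrans_comp mulrA.
Qed.

Lemma word_cat p q (w : word (p + q)) :
  exists a b, w = cat_tuple a b :> word (p + q).
Proof.
have sa : size (take p w) == p by rewrite size_takel // size_tuple leq_addr.
have sb : size (drop p w) == q by rewrite size_drop size_tuple addKn.
by exists (Tuple sa), (Tuple sb); apply: val_inj; rewrite /= cat_take_drop.
Qed.

Lemma cat_tuple_inj p q (a a' : word p) (b b' : word q) :
  (cat_tuple a b == cat_tuple a' b') = (a == a') && (b == b').
Proof. by rewrite -!val_eqE /= eqseq_cat // !size_tuple. Qed.

Lemma tensp_universal p q (V : zmodType) (phi : tpow p -> tpow q -> V) :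
    (forall v, {morph phi^~ v : u u' / u + u'}) ->
    (forall u, {morph phi u : v v' / v + v'}) ->
    (forall u f v, phi (ract u f) v = phi u (f *: v)) ->
  exists psi : tpow (p + q) -> V,
    [/\ {morph psi : x y / x + y}, forall u v, psi (tensp u v) = phi u v &
        forall psi' : tpow (p + q) -> V, {morph psi' : x y / x + y} ->
          (forall u v, psi' (tensp u v) = phi u v) -> psi' =1 psi].
Proof.
move=> phiDl phiDr phiB.
have mor0 (U : nmodType) (f : U -> V) : {morph f : x y / x + y} -> f 0 = 0.
  by move=> fD; apply: (addrI (f 0)); rewrite -fD !addr0.
pose psi (x : tpow (p + q)) : V :=
  \sum_(a : word p) \sum_(b : word q) phi (x (cat_tuple a b) *: tbasis a) (tbasis b).
have psiD : {morph psi : x y / x + y}.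
  move=> x y; rewrite -big_split; apply: eq_bigr => a _; rewrite -big_split.
  by apply: eq_bigr => b _; rewrite ffunE scalerDl phiDl.
have psiB h (a : word p) (b : word q) :
    psi (h *: tbasis (cat_tuple a b)) = phi (h *: tbasis a) (tbasis b).
  have z u' v' : u' = 0 -> phi u' v' = 0 by move=> ->; apply: mor0 (phiDl v').
  rewrite /psi (bigD1 a) //= [X in _ + X]big1 ?addr0; last first.
    move=> a' a'a; rewrite big1 // => b' _; apply: z.
    by rewrite !ffunE cat_tuple_inj (negPf a'a) [X in X *: _]mulr0 scale0r.
  rewrite (bigD1 b) //= [X in _ + X]big1 ?addr0; last first.
    move=> b' b'b; apply: z.
    by rewrite !ffunE cat_tuple_inj (negPf b'b) andbF [X in X *: _]mulr0 scale0r.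
  by rewrite !ffunE eqxx [X in X *: _]mulr1.
have ext f g : {morph f : x y / x + y} -> {morph g : x y / x + y} ->
    (forall h a b, f (h *: tbasis (cat_tuple a b)) = g (h *: tbasis (cat_tuple a b))) ->
    f =1 g :> (tpow (p + q) -> V).
  move=> fD gD fg x; rewrite [x]tpowE (big_morph f fD (mor0 _ _ fD)).
  rewrite (big_morph g gD (mor0 _ _ gD)); apply: eq_bigr => w _.
  by have [a [b ->]] := word_cat w.
exists psi; split=> // [u v|psi' psi'D psi'E].
  rewrite /tensp (big_morph psi psiD (mor0 _ _ psiD)).
  rewrite [in RHS](tpowE u) (big_morph _ (phiDl v) (mor0 _ _ (phiDl v))).
  apply: eq_bigr => a _; rewrite (big_morph psi psiD (mor0 _ _ psiD)).
  rewrite [in RHS](tpowE v) (big_morph _ (phiDr _) (mor0 _ _ (phiDr _))).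
  apply: eq_bigr => b _; rewrite psiB -phiB; congr (phi _ _).
  by rewrite ractZ ract_tbasis scalerA.
apply: ext => // h a b.
by rewrite psiB -psi'E tensp_Zl tensp_tbasis.
Qed.

Fixpoint braid_seq (i : nat) (s : seq class_elt) {struct s} : seq class_elt :=
  match i, s with
  | 0, a :: (b :: s') => ad a b :: a :: s'
  | j.+1, a :: s' => a :: braid_seq j s'
  | _, _ => s
  end.

Lemma size_braid_seq i s : size (braid_seq i s) = size s.
Proof.
by elim: s i => [|a s IH] [|i] //=; [case: s {IH} | rewrite IH].
Qed.

Lemma braid_word_subproof i m (w : word m) : size (braid_seq i w) == m.
Proof. by rewrite size_braid_seq size_tuple. Qed.

Definition braid_word i m (w : word m) : word m := Tuple (braid_word_subproof i w).

(* Psi in the places i and i+1 counted from 0 (so Psi_{i+1,i+2} in the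
   1-based notation); it is the identity when i + 1 >= m. *)
Definition Psi i m (u : tpow m) : tpow m :=
  \sum_(w : word m) u w *: tbasis (braid_word i w).

(* Psi_{j} \o Psi_{j+1} \o ... \o Psi_{j+i-1} *)
Definition Psi_chain j i m : tpow m -> tpow m :=
  foldr (fun l f => Psi l (m := m) \o f) idfun (iota j i).

(* id^{(x) j} (x) [k, -Psi], acting in the places j, ..., j+k-1 *)
Definition braided_int j k m (u : tpow m) : tpow m :=
  \sum_(i < k) (-1) ^+ i *: Psi_chain j i u.

(* The factor for k = 2 is applied last; A_0 and A_1 are identities. *)
Definition antisym m : tpow m -> tpow m :=
  foldr (fun k f => braided_int (m - k) k (m := m) \o f) idfun (iota 2 m.-1).

Lemma Psi_linear i m : linear (@Psi i m).
Proof.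
move=> h u v; rewrite /Psi scaler_sumr -big_split /=; apply: eq_bigr => w _.
by rewrite !ffunE scalerDl scalerA.
Qed.

HB.instance Definition _ i m :=
  GRing.isLinear.Build H (tpow m) (tpow m) _ (@Psi i m) (@Psi_linear i m).

Lemma Psi_tbasis i m (w : word m) : Psi i (tbasis w) = tbasis (braid_word i w).
Proof.
rewrite /Psi (bigD1 w) //= big1 ?addr0 => [|v vw]; rewrite ffunE ?eqxx ?scale1r //.
by rewrite (negPf vw) scale0r.
Qed.

Lemma Psi_pair (a b : class_elt) :
  Psi 0 (tbasis [tuple a; b]) = tbasis [tuple ad a b; a].
Proof. by rewrite Psi_tbasis; congr tbasis; apply: val_inj. Qed.

Lemma Psi_Z i m h (u : tpow m) : Psi i (h *: u) = h *: Psi i u.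
Proof. by rewrite -[_ *: u]addr0 Psi_linear raddf0 addr0. Qed.

Lemma wprod_braid i m (w : word m) : wprod (braid_word i w) = wprod w.
Proof.
rewrite /wprod /=; elim: (tval w) i => [|a s IH] [|i] //=; last by rewrite !big_cons IH.
by case: s {IH} => [|b s] //; rewrite !big_cons /= /Ad !mulgA mulgKV.
Qed.

Lemma Psi_ract i m (u : tpow m) f : Psi i (ract u f) = ract (Psi i u) f.
Proof.
have r0 : ract (0 : tpow m) f = 0 by apply/ffunP=> w; rewrite !ffunE mul0r.
rewrite {2}/Psi (big_morph _ (@ractDl m f) r0); apply: eq_bigr => w _.
by rewrite ractZ ract_tbasis wprod_braid scalerA ffunE.
Qed.

Lemma braid_seq_catr (s t : seq class_elt) i :
  braid_seq (size s + i) (s ++ t) = s ++ braid_seq i t.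
Proof. by elim: s => //= a s ->. Qed.

Lemma Psi_tensp p q (u : tpow p) (r : tpow 2) (v : tpow q) :
  Psi p (tensp u (tensp r v)) = tensp u (tensp (Psi 0 r) v).
Proof.
have tl n k (y : tpow k) : tensp (0 : tpow n) y = 0.
  by rewrite -[0](scale0r 0) tensp_Zl !scale0r.
have tr n k (x : tpow n) : tensp x (0 : tpow k) = 0.
  by apply: (addrI (tensp x 0)); rewrite -tensp_Dr !addr0.
have sl n k (y : tpow k) := big_morph _ (@tensp_Dl n k y) (tl n k y).
have sr n k (x : tpow n) := big_morph _ (@tensp_Dr n k x) (tr n k x).
have sp i m I (l : seq I) P (E : I -> tpow m) :
    Psi i (\sum_(k <- l | P k) E k) = \sum_(k <- l | P k) Psi i (E k).
  exact: raddf_sum.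
move Er': (Psi 0 r) => r'.
rewrite [u]tpowE !sl sp; apply: eq_bigr => a _.
rewrite !tensp_Zl Psi_Z; congr (_ *: _).
rewrite -{}Er' [r]tpowE [Psi 0 _]sp !sl !sr sp; apply: eq_bigr => w _.
rewrite Psi_Z !tensp_Zl -!tensp_balanced ract_tbasis !tensp_Zl Psi_Z.
congr (_ *: _); rewrite Psi_tbasis [v]tpowE.
rewrite [tensp (tbasis w) _]sr [tensp (tbasis (braid_word 0 w)) _]sr.
rewrite 2!(sr _ _ (tbasis a)) sp; apply: eq_bigr => b _.
rewrite -!tensp_balanced !ract_tbasis wprod_braid !tensp_Zl -!tensp_balanced.
rewrite !ract_tbasis !tensp_Zl Psi_Z.
congr (_ *: _); rewrite !tensp_tbasis Psi_tbasis; congr tbasis.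
apply: val_inj; rewrite /= -[p in braid_seq p]addn0 -{1}(size_tuple a).
rewrite braid_seq_catr; congr (_ ++ _).
by case: w => [[|x [|y [|z s]]]] /=.
Qed.

Lemma Psi_chain_linear j i m : linear (@Psi_chain j i m).
Proof.
rewrite /Psi_chain; elim: (iota j i) => [|l s IH] h u v //=.
by rewrite IH Psi_linear.
Qed.

Lemma sign_scale m i (h : H) (u : tpow m) :
  (-1) ^+ i *: (h *: u) = h *: ((-1) ^+ i *: u).
Proof.
rewrite !scalerA -signr_odd.
by case: odd; rewrite ?mulN1r ?mulrN1 ?mul1r ?mulr1.
Qed.

Lemma braided_int_linear j k m : linear (@braided_int j k m).
Proof.
move=> h u v; rewrite /braided_int scaler_sumr -big_split /=.
by apply: eq_bigr => i _; rewrite Psi_chain_linear scalerDr sign_scale.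
Qed.

Lemma antisym_linear m : linear (@antisym m).
Proof.
rewrite /antisym; elim: (iota 2 _) => [|k s IH] h u v //=.
by rewrite IH braided_int_linear.
Qed.

HB.instance Definition _ m :=
  GRing.isLinear.Build H (tpow m) (tpow m) _ (@antisym m) (@antisym_linear m).

Definition ker_antisym m : {pred tpow m} := [pred u | antisym u == 0].

Lemma ker_antisymE m (u : tpow m) : (u \in @ker_antisym m) = (antisym u == 0).
Proof. by []. Qed.

Lemma ker_antisym_zmod_closed m : zmod_closed (@ker_antisym m).
Proof.
split=> [|u v]; rewrite !ker_antisymE ?raddf0 // => /eqP u0 /eqP v0.
by rewrite raddfB /= u0 v0 subr0.
Qed.

HB.instance Definition _ m :=
  GRing.isZmodClosed.Build (tpow m) (@ker_antisym m) (@ker_antisym_zmod_closed m).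

(* As A_0 and A_1 are identities, Omega 0 and Omega 1 are copies of tpow 0 = H
   and tpow 1 = Omega^1(H). *)
Definition Omega (m : nat) : Type := @Quotient.quot (tpow m) (@ker_antisym m).

HB.instance Definition _ m := GRing.Zmodule.on (Omega m).

Definition Omega_scale m (h : H) (u : Omega m) : Omega m :=
  \pi_(Quotient.quot (@ker_antisym m)) (h *: repr u).

Lemma Omega_scale_pi m h (u : tpow m) :
  Omega_scale h (\pi_(Quotient.quot (@ker_antisym m)) u) =
  \pi_(Quotient.quot (@ker_antisym m)) (h *: u).
Proof.
apply/eqP; rewrite /Omega_scale -Quotient.idealrBE -scalerBr ker_antisymE.
set x := _ - u; have: x \in @ker_antisym m by rewrite Quotient.idealrBE reprK.
rewrite ker_antisymE => /eqP x0.
by rewrite -[h *: x]addr0 antisym_linear x0 scaler0 add0r raddf0.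
Qed.

Lemma Omega_ind m (P : Omega m -> Prop) :
  (forall u : tpow m, P (\pi_(@Quotient.quot (tpow m) (@ker_antisym m)) u)) ->
  forall u, P u.
Proof. by move=> Ppi u; rewrite -[u]reprK; apply: Ppi. Qed.

Lemma Omega_scaleA m h k (u : Omega m) :
  Omega_scale h (Omega_scale k u) = Omega_scale (h * k) u.
Proof. by elim/Omega_ind: u => u; rewrite (Omega_scale_pi k) (Omega_scale_pi h) (Omega_scale_pi (h * k)) scalerA. Qed.

Lemma Omega_scale1 m : left_id 1 (@Omega_scale m).
Proof. by elim/Omega_ind => u; rewrite Omega_scale_pi scale1r. Qed.

Lemma Omega_scaleDr m : right_distributive (@Omega_scale m) +%R.
Proof.
move=> h; elim/Omega_ind => u; elim/Omega_ind => v.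
by rewrite -raddfD !Omega_scale_pi scalerDr raddfD.
Qed.

Lemma Omega_scaleDl m (u : Omega m) : {morph (@Omega_scale m)^~ u : h k / h + k}.
Proof.
by elim/Omega_ind: u => u h k; rewrite !Omega_scale_pi scalerDl raddfD.
Qed.

HB.instance Definition _ m :=
  GRing.Zmodule_isLmodule.Build H (Omega m) (@Omega_scaleA m) (@Omega_scale1 m)
    (@Omega_scaleDr m) (@Omega_scaleDl m).

(* The degree m component of the two-sided ideal of the tensor algebra of
   Omega^1(H) over H generated by ker A_2.  The coefficient u absorbs the
   left multiplications by H. *)
Inductive deg2_generated : forall m : nat, tpow m -> Prop :=
| deg2_gen p q (u : tpow p) (r : tpow 2) (v : tpow q) :
    r \in @ker_antisym 2 -> deg2_generated (tensp u (tensp r v))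
| deg2_zero m : deg2_generated (0 : tpow m)
| deg2_add m (u v : tpow m) :
    deg2_generated u -> deg2_generated v -> deg2_generated (u + v).

(* The product of Omega being induced by the tensor product, the relations of
   Omega in degree m are the elements of ker A_m. *)
Definition additional_relation m (u : tpow m) : Prop :=
  u \in @ker_antisym m /\ ~ deg2_generated u.

Definition quadratic : Prop :=
  forall m (u : tpow m), u \in @ker_antisym m -> deg2_generated u.

End WoronowiczAlgebra.

(* Main.v *)
(* Label t, x, y, z by 0, 1, 2, 3.  The kernel of A_m is computed without forming A_m.
   Writing [m, -Psi] u as the sum over a of e_a (x) d_a u, one has A_m u = 0 iff
   A_(m-1) (d_a u) = 0 for all a, and d_(aba^-1) (e_a w) = delta w - e_a (d_b w).  It
   therefore suffices to exhibit a graded algebra B that is generated by the letters,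
   carries operators D_a obeying this skew Leibniz rule, and has no nonzero element of
   positive degree killed by every D_a: then ker A_m is the kernel of T^m -> B_m.  Here B
   is the 72-dimensional algebra presented by the rewriting system [rules].  For the
   last property, the operator S = sum_a e_a D_a satisfies on each B_m, m > 0, a cubic
   equation with nonzero constant term, so S v = 0 forces v = 0.
   Up to degree 5 only rules that follow from the quadratic relations apply, so there
   is no further relation.  On the other hand w = (210)^2 + (102)^2 + (021)^2 vanishes in
   B, while on a 6-dimensional representation of the quadratic algebra it fixes vectors
   that are images of words v of every length; so w v is an additional relation in
   every degree >= 6. *)
Require Import Defs.
From HB Require Import structures.
From mathcomp Require Import all_boot all_order all_fingroup all_algebra.
From mathcomp Require Import generic_quotient ring_quotient.
From mathcomp Require Import reals complex.

Set Implicit Arguments.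
Unset Strict Implicit.
Unset Printing Implicit Defensive.

Import GRing.Theory.

(** * Formal integer combinations *)

Section FormalSums.
Local Open Scope ring_scope.
Variable K : eqType.

Definition fscale (k : int) (p : seq (int * K)) := [seq (k * t.1, t.2) | t <- p].

Definition fcoef (p : seq (int * K)) (s : K) : int :=
  foldr (fun t x => if t.2 == s then t.1 + x else x) 0 p.

(** Merging equal keys and dropping zero coefficients keeps sums short during the finite
    computations; evaluation is unchanged by [feval_collect]. *)
Definition fcollect (p : seq (int * K)) :=
  [seq t <- [seq (fcoef p s, s) | s <- undup [seq t.2 | t <- p]] | t.1 != 0].

(** A key outside both lists has coefficient 0 on both sides, so finitely many comparisons decide
    equality in the free abelian group. *)
Definition feq (p q : seq (int * K)) :=
  all (fun t => fcoef p t.2 == fcoef q t.2) (p ++ q).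

Definition fext (g : K -> seq (int * K)) (p : seq (int * K)) :=
  fcollect (flatten [seq fscale t.1 (g t.2) | t <- p]).

(** The word [t] acts as an iterated left multiplication, its last letter first. *)
Definition chain (f : nat -> K -> seq (int * K)) (t : seq nat) (p : seq (int * K)) :=
  foldr (fun a => fext (f a)) p t.

Definition fsupp (P : pred K) (p : seq (int * K)) := all (fun t => P t.2) p.

Section Eval.
Variables (V : zmodType) (f : K -> V).

Definition feval (p : seq (int * K)) : V := \sum_(t <- p) f t.2 *~ t.1.

Lemma feval_nil : feval [::] = 0.
Proof. by rewrite /feval big_nil. Qed.

Lemma feval_cons t p : feval (t :: p) = f t.2 *~ t.1 + feval p.
Proof. by rewrite /feval big_cons. Qed.

Lemma feval1 k s : feval [:: (k, s)] = f s *~ k.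
Proof. by rewrite feval_cons feval_nil addr0. Qed.

Lemma feval_cat p q : feval (p ++ q) = feval p + feval q.
Proof. by rewrite /feval big_cat. Qed.

Lemma feval_scale k p : feval (fscale k p) = feval p *~ k.
Proof.
rewrite /feval big_map /= mulrz_suml; apply: eq_bigr => t _.
by rewrite -mulrzA mulrC.
Qed.

Lemma feval_flatten (T : Type) (h : T -> seq (int * K)) (l : seq T) :
  feval (flatten [seq h t | t <- l]) = \sum_(t <- l) feval (h t).
Proof. by elim: l => [|t l IH]; rewrite ?big_nil ?feval_nil // big_cons feval_cat IH. Qed.

Lemma fevalE p (r : seq K) :
    uniq r -> {subset [seq t.2 | t <- p] <= r} ->
  feval p = \sum_(s <- r) f s *~ fcoef p s.
Proof.
move=> ur; elim: p => [|[k s] p IH] sub; first by rewrite feval_nil big1.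
rewrite feval_cons IH /= => [|x xp]; last by apply: sub; rewrite inE xp orbT.
have sr : s \in r by apply: sub; rewrite inE eqxx.
rewrite (big_rem s sr) [in RHS](big_rem s sr) /= eqxx mulrzDr addrA; congr (_ + _).
rewrite big_seq [RHS]big_seq; apply: eq_bigr => x.
by rewrite mem_rem_uniq // inE => /andP[/negPf]; rewrite eq_sym => ->.
Qed.

Lemma feval_collect p : feval (fcollect p) = feval p.
Proof.
rewrite [RHS](fevalE (undup_uniq [seq t.2 | t <- p])) => [|x]; last by rewrite mem_undup.
rewrite /feval /fcollect big_filter big_mkcond big_map; apply: eq_bigr => s _ /=.
by case: eqP => // ->.
Qed.

Lemma feval_eq p q : feq p q -> feval p = feval q.
Proof.
move=> pq; pose r := undup [seq t.2 | t <- p ++ q].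
have sub : {subset [seq t.2 | t <- p] <= r} /\ {subset [seq t.2 | t <- q] <= r}.
  by split=> x xp; rewrite mem_undup map_cat mem_cat xp ?orbT.
rewrite (fevalE (undup_uniq _) sub.1) (fevalE (undup_uniq _) sub.2).
rewrite big_seq [RHS]big_seq; apply: eq_bigr => s.
by rewrite mem_undup => /mapP[t tpq ->]; rewrite (eqP (allP pq t tpq)).
Qed.

End Eval.

Lemma eq_feval (V : zmodType) (f g : K -> V) (P : pred K) p :
  fsupp P p -> (forall s, P s -> f s = g s) -> feval f p = feval g p.
Proof.
by move=> /allP sP fg; rewrite /feval !big_seq; apply: eq_bigr => t /sP /fg ->.
Qed.

Lemma raddf_feval (V W : zmodType) (h : {additive V -> W}) (f : K -> V) p :
  h (feval f p) = feval (h \o f) p.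
Proof. by rewrite raddf_sum; apply: eq_bigr => t _; rewrite raddfMz. Qed.

Lemma feval_ext (V : zmodType) (f : K -> V) g p :
  feval f (fext g p) = feval (fun s => feval f (g s)) p.
Proof.
by rewrite feval_collect feval_flatten; apply: eq_bigr => t _; rewrite feval_scale.
Qed.

Lemma fsupp_ext (P Q : pred K) g p :
  fsupp P p -> (forall s, P s -> fsupp Q (g s)) -> fsupp Q (fext g p).
Proof.
move=> /allP sP gQ; apply/allP => t.
rewrite mem_filter => /andP[_ /mapP[s + ->]] /=.
rewrite mem_undup => /mapP[{}t + ->].
move=> /flattenP[q /mapP[r /sP/gQ rQ ->]] /mapP[u urQ ->] /=.
exact: (allP rQ).
Qed.

End FormalSums.

(** * Coordinates and matrices with respect to a finite basis *)

Section Coordinates.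
Local Open Scope ring_scope.
Variables (H : pzRingType) (K : eqType) (B : seq K).
Hypothesis uB : uniq B.

(** This is zero when [s] is outside [B], whence the support conditions below. Vectors are rows, so
    matrices multiply in the reverse order of operators. *)
Definition bvec (s : K) : 'rV[H]_(size B) := \row_j (s == tnth (in_tuple B) j)%:R.

Definition gmx (g : K -> seq (int * K)) : 'M[H]_(size B) :=
  \matrix_i feval bvec (g (tnth (in_tuple B) i)).

Lemma bvec_tnth i : bvec (tnth (in_tuple B) i) = delta_mx 0 i.
Proof.
apply/rowP => j; rewrite !mxE eqxx /= (inj_eq _) 1?eq_sym //.
exact/tuple_uniqP.
Qed.

Lemma in_tnth s : s \in B -> exists i, s = tnth (in_tuple B) i.
Proof. by move=> sB; apply/tnthP. Qed.

Lemma bvec_gmx g s : s \in B -> bvec s *m gmx g = feval bvec (g s).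
Proof. by move=> /in_tnth[i ->]; rewrite bvec_tnth -rowE rowK. Qed.

Lemma feval_gmx g p :
  fsupp [in B] p -> feval bvec p *m gmx g = feval bvec (fext g p).
Proof.
move=> sB; rewrite feval_ext -[LHS]/(mulmxr _ _) raddf_feval /=.
by apply: eq_feval sB _ => s /= /bvec_gmx.
Qed.

Lemma eq_mx_bvec (M N : 'M[H]_(size B)) :
  (forall s, s \in B -> bvec s *m M = bvec s *m N) -> M = N.
Proof.
move=> MN; apply/row_matrixP => i; rewrite !rowE -bvec_tnth MN //.
exact: (mem_tnth i (in_tuple B)).
Qed.

Lemma feval_chain (f : nat -> K -> seq (int * K)) t p :
    (forall a s, a \in t -> s \in B -> fsupp [in B] (f a s)) -> fsupp [in B] p ->
  fsupp [in B] (chain f t p) /\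
  feval bvec (chain f t p) = foldr (fun a v => v *m gmx (f a)) (feval bvec p) t.
Proof.
move=> fB pB; elim: t fB => //= a t IH fB.
have [|tB <-] := IH; first by move=> b s bt; apply: fB; rewrite inE bt orbT.
split; last by rewrite feval_gmx.
by apply: fsupp_ext tB _ => s; apply: fB; rewrite inE eqxx.
Qed.

Lemma foldr_mulmx (M : nat -> 'M[H]_(size B)) (v : 'rV[H]_(size B)) t :
  foldr (fun a v => v *m M a) v t = v *m foldr (fun a N => N *m M a) 1%:M t.
Proof. by elim: t => [|a t IH] /=; rewrite ?mulmx1 // IH mulmxA. Qed.

End Coordinates.

(** * The rewriting system of the Nichols algebra *)

(* The affine rack b |-> w b + w^2 a on the field F_4 = {0, 1, w, w^2}, with w and w^2
   coded by 2 and 3; each translation has order 3, whence [rackV]. *)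
Definition rack (a b : nat) : nat :=
  nth 0 (nth [::] [:: [:: 0; 2; 3; 1]; [:: 3; 1; 0; 2]; [:: 1; 3; 2; 0]; [:: 2; 0; 1; 3]] a) b.

Definition rackV (a b : nat) : nat := rack a (rack a b).

Local Notation fsum := (seq (int * seq nat)).

(* A Groebner basis of the quadratic relations for deglex with 0 < 1 < 2 < 3; the last two
   rules are braid relations, which follow from the others in degree 3. *)
Definition quad_rules : seq (seq nat * fsum) :=
  [:: ([:: 0; 0], [::]); ([:: 1; 1], [::]); ([:: 2; 2], [::]); ([:: 3; 3], [::]);
      ([:: 2; 0], [:: ((-1)%R, [:: 1; 2]); ((-1)%R, [:: 0; 1])]);
      ([:: 3; 0], [:: ((-1)%R, [:: 2; 3]); ((-1)%R, [:: 0; 2])]);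
      ([:: 3; 1], [:: ((-1)%R, [:: 0; 3]); ((-1)%R, [:: 1; 0])]);
      ([:: 3; 2], [:: ((-1)%R, [:: 1; 3]); ((-1)%R, [:: 2; 1])]);
      ([:: 1; 0; 1], [:: (1%R, [:: 0; 1; 0])]);
      ([:: 2; 1; 2], [:: (1%R, [:: 1; 2; 1])])].

(** The added rule solves the relation w = 0 of degree 6 for its largest word. *)
Definition rules : seq (seq nat * fsum) :=
  rcons quad_rules ([:: 2; 1; 0; 2; 1; 0],
    [:: ((-1)%R, [:: 1; 0; 2; 1; 0; 2]); ((-1)%R, [:: 0; 2; 1; 0; 2; 1])]).

(** In [a :: v] with [v] normal, a left-hand side can occur only at the head, so prefixes
    suffice. *)
Definition head_rules (s : seq nat) := [seq r <- rules | prefix r.1 s].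

(* Normal form of [a :: v] for normal [v]; the fuel [n] bounds the depth of the rewriting,
   and when it runs out the word is returned as it is. *)
Fixpoint lmul_rec (n a : nat) (v : seq nat) : fsum :=
  if n is n'.+1 then
    if head_rules (a :: v) is r :: _ then
      fext (fun t => chain (lmul_rec n') t [:: (1%R, drop (size r.1) (a :: v))]) r.2
    else [:: (1%R, a :: v)]
  else [:: (1%R, a :: v)].

Definition lmul : nat -> seq nat -> fsum := lmul_rec 30.

Fixpoint dif (c : nat) (v : seq nat) : fsum :=
  if v is a :: v' then
    (if a == c then [:: (1%R, v')] else [::])
    ++ fscale (-1)%R (fext (lmul a) (dif (rackV a c) v'))
  else [::].

(** The operator S, a braided counterpart of the Euler operator sum of x_i d/dx_i. *)
Definition euler (v : seq nat) : fsum :=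
  flatten [seq fext (lmul c) (dif c v) | c <- iota 0 4].

(** A word is normal when its tail is normal and no rule applies at its head. Starting from the
    empty word, the ten terms of the trajectory are the normal words of lengths 0 to 9. *)
Definition next_words (ws : seq (seq nat)) :=
  [seq a :: v | a <- iota 0 4, v <- [seq v <- ws | nilp (head_rules (a :: v))]].

(* Locked so that the unifier does not enumerate it. *)
HB.lock Definition nwords : seq (seq nat) := flatten (traject next_words [:: [::]] 10).

Definition sixth_words :=
  [:: [:: 2; 1; 0; 2; 1; 0]; [:: 1; 0; 2; 1; 0; 2]; [:: 0; 2; 1; 0; 2; 1]].

(* On degree m > 0, S^3 + b S = a S^2 + k for (a, b, k) = [euler_cubic m]: a multiple of
   the minimal polynomial of S, padded to degree 3. *)
Definition euler_cubic (m : nat) : int * int * int :=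
  nth (0, 0, 0)%R
    [:: (0, 0, 1)%R; (0, 0, 1)%R; (4, 6, 3)%R; (4, 8, 8)%R; (6, 12, 9)%R; (6, 12, 7)%R;
        (8, 24, 24)%R; (6, 12, 7)%R; (0, 0, 27)%R; (0, 0, 64)%R] m.

(** * Finite checks on the normal words *)

Lemma nwords_uniq : uniq nwords.
Proof. by rewrite nwords.unlock; vm_compute. Qed.

Lemma nwords_size : all (fun s => size s < 10) nwords.
Proof. by rewrite nwords.unlock; vm_compute. Qed.

Lemma nil_nwords : [::] \in nwords.
Proof. by rewrite nwords.unlock; vm_compute. Qed.

Lemma nwords_letters : all (all (fun a => a < 4)) nwords.
Proof. by rewrite nwords.unlock; vm_compute. Qed.

Lemma count_nwords m : m < 10 ->
  count (fun s => size s == m) nwords = nth 0 [:: 1; 4; 8; 11; 12; 12; 11; 8; 4; 1] m.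
Proof. by rewrite nwords.unlock; do 10?case: m => [|m] //; vm_compute. Qed.

Lemma nwords_suffix a v : a :: v \in nwords ->
  v \in nwords /\ lmul a v = [:: (1%R, a :: v)].
Proof.
have /allP H : all (fun s => if s is a :: v then (v \in nwords) &&
    (lmul a v == [:: (1%R, a :: v)]) else true) nwords.
  by rewrite nwords.unlock; vm_compute.
by move=> /H /andP[-> /eqP->].
Qed.

(** Besides closure and grading, this contains the vanishing in degree 10: no normal word has that
    length, so a letter times a word of length 9 is the empty sum. *)
Lemma lmul_supp a v : a < 4 -> v \in nwords ->
  fsupp (fun s => (s \in nwords) && (size s == (size v).+1)) (lmul a v).
Proof.
have /allP H : all (fun v => all (fun a =>
    fsupp (fun s => (s \in nwords) && (size s == (size v).+1)) (lmul a v)) (iota 0 4)) nwords.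
  by rewrite nwords.unlock; vm_compute.
by move=> a4 /H /allP; apply; rewrite mem_iota.
Qed.

Lemma dif_supp a v : a < 4 -> v \in nwords -> fsupp [in nwords] (dif a v).
Proof.
have /allP H : all (fun v => all (fun a =>
    fsupp [in nwords] (dif a v)) (iota 0 4)) nwords by rewrite nwords.unlock; vm_compute.
by move=> a4 /H /allP; apply; rewrite mem_iota.
Qed.

(** The skew Leibniz rule defines [dif] by recursion on the letters of a word. Here it is checked to
    persist when [a :: v] has to be rewritten, so that the operators are compatible with the
    relations. *)
Lemma dif_lmul a c v : a < 4 -> c < 4 -> v \in nwords ->
  feq (fext (dif c) (lmul a v))
      ((if a == c then [:: (1%R, v)] else [::])
       ++ fscale (-1)%R (fext (lmul a) (dif (rackV a c) v))).
Proof.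
have /allP H : all (fun v => all (fun a => all (fun c =>
  feq (fext (dif c) (lmul a v))
      ((if a == c then [:: (1%R, v)] else [::])
       ++ fscale (-1)%R (fext (lmul a) (dif (rackV a c) v)))) (iota 0 4)) (iota 0 4)) nwords.
  by rewrite nwords.unlock; vm_compute.
move=> a4 c4 /H /allP/(_ a); rewrite mem_iota => /(_ a4) /allP; apply.
by rewrite mem_iota.
Qed.

Lemma euler_cubicP v : v \in nwords -> v != [::] ->
  let: (a, b, k) := euler_cubic (size v) in
  feq (fext euler (fext euler (euler v)) ++ fscale b (euler v))
      (fscale a (fext euler (euler v)) ++ [:: (k, v)]).
Proof.
have /allP H : all (fun v => (v == [::]) || let: (a, b, k) := euler_cubic (size v) in
  feq (fext euler (fext euler (euler v)) ++ fscale b (euler v))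
      (fscale a (fext euler (euler v)) ++ [:: (k, v)])) nwords.
  by rewrite nwords.unlock; vm_compute.
by move=> /H /orP[->//|].
Qed.

(** Left multiplication by w is zero on all of B; the case [v = [::]] is the relation w = 0
    itself. *)
Lemma sixth_relation v : v \in nwords ->
  feq (flatten [seq chain lmul t [:: (1%R, v)] | t <- sixth_words]) [::].
Proof.
have /allP H : all (fun v =>
  feq (flatten [seq chain lmul t [:: (1%R, v)] | t <- sixth_words]) [::]) nwords.
  by rewrite nwords.unlock; vm_compute.
exact: H.
Qed.

(* The left ideal of the quadratic algebra generated by the word 012 has rank 2 in each
   degree and its structure constants have period 3; [(b, n)] stands for its basis vector
   number b in degree n modulo 3. *)
Definition state_act (a : nat) (s : bool * nat) : seq (int * (bool * nat)) :=
  let n := s.2.+1 %% 3 in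
  match s.1 with
  | false => if a == n then [:: (1%R, (false, n))]
             else if a == 3 then [:: (1%R, (true, n))] else [::]
  | true => if a == s.2 then [:: ((-1)%R, (false, n))]
            else if a == s.2.+2 %% 3 then [:: ((-1)%R, (true, n))] else [::]
  end.

Definition states := [seq (b, n) | b <- [:: false; true], n <- iota 0 3].

Lemma states_uniq : uniq states.
Proof. by []. Qed.

Lemma state_act_supp a s : a < 4 -> s \in states -> fsupp [in states] (state_act a s).
Proof.
have /allP H : all (fun s => all (fun a => fsupp [in states] (state_act a s)) (iota 0 4)) states.
  by vm_compute.
by move=> a4 /H /allP; apply; rewrite mem_iota.
Qed.

(** With x the image of b under a, the words ab, xa, bx form an orbit of Psi; the vanishing of their
    sum makes the states a representation of the quadratic algebra. *)
Lemma state_act_quad a b s : a < 4 -> b < 4 -> s \in states ->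
  feq (fext (state_act a) (state_act b s) ++ fext (state_act (rack a b)) (state_act a s)
       ++ fext (state_act b) (state_act (rack a b) s)) [::].
Proof.
have /allP H : all (fun s => all (fun a => all (fun b =>
  feq (fext (state_act a) (state_act b s) ++ fext (state_act (rack a b)) (state_act a s)
       ++ fext (state_act b) (state_act (rack a b) s)) [::]) (iota 0 4)) (iota 0 4)) states.
  by vm_compute.
move=> a4 b4 /H /allP/(_ a); rewrite mem_iota => /(_ a4) /allP; apply.
by rewrite mem_iota.
Qed.

Lemma sixth_words_state n : n < 3 ->
  feq (flatten [seq chain state_act t [:: (1%R, (false, n))] | t <- sixth_words])
      [:: (1%R, (false, n))].
Proof. by case: n => [|[|[|]]] // _; vm_compute. Qed.

Lemma rackV_lt a c : a < 4 -> c < 4 -> rackV a c < 4.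
Proof. by move: a c => [|[|[|[|a]]]] [|[|[|[|c]]]]. Qed.

Lemma rack_lt a c : a < 4 -> c < 4 -> rack a c < 4.
Proof. by move: a c => [|[|[|[|a]]]] [|[|[|[|c]]]]. Qed.

Lemma rackK a b c : a < 4 -> b < 4 -> c < 4 -> (rack a b == c) = (b == rackV a c).
Proof.
by move: a b c => [|[|[|[|a]]]] [|[|[|[|b]]]] [|[|[|[|c]]]].
Qed.

Lemma mulmxzE (V : zmodType) m n (A : 'M[V]_(m, n)) k i j :
  ((A *~ k) i j = A i j *~ k)%R.
Proof.
by case: k => k; rewrite ?NegzE ?mulrNz ?mxE -!pmulrn mulmxnE.
Qed.

(** * The algebra B on row vectors, and its nondegeneracy *)

Local Notation nword j := (tnth (in_tuple nwords) j).

Section NormalForm.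
Local Open Scope ring_scope.
Variable H : pzRingType.

Local Notation bv := (bvec H nwords).
Local Notation n := (size nwords).
Local Notation Lmx a := (gmx H nwords (lmul a)).
Local Notation Dmx c := (gmx H nwords (dif c)).
Local Notation Emx := (gmx H nwords euler).

Definition nfvec (s : seq nat) : 'rV[H]_n := foldr (fun a v => v *m Lmx a) (bv [::]) s.

Lemma lmul_in a v : (a < 4)%N -> v \in nwords -> fsupp [in nwords] (lmul a v).
Proof.
by move=> a4 vN; apply: sub_all (lmul_supp a4 vN) => t /andP[].
Qed.

Lemma gmx_dif_nil c : bv [::] *m Dmx c = 0.
Proof. by rewrite bvec_gmx ?nwords_uniq ?nil_nwords // feval_nil. Qed.

Lemma gmx_lmul_dif a c : (a < 4)%N -> (c < 4)%N ->
  Lmx a *m Dmx c = (a == c)%:R%:M - Dmx (rackV a c) *m Lmx a.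
Proof.
move=> a4 c4; apply: (eq_mx_bvec nwords_uniq) => s sN.
have uN := nwords_uniq.
rewrite mulmxA (bvec_gmx _ uN) // feval_gmx //; last exact: lmul_in.
rewrite (feval_eq _ (dif_lmul a4 c4 sN)) feval_cat feval_scale mulmxBr mulmxA.
rewrite (bvec_gmx _ uN) // [in RHS]feval_gmx //; last by rewrite dif_supp ?rackV_lt.
rewrite mulrN1z; congr (_ - _); case: eqP => _; first by rewrite feval1 mulmx1.
by rewrite feval_nil raddf0 mulmx0.
Qed.

Lemma gmx_euler : Emx = \sum_(c <- iota 0 4) Dmx c *m Lmx c.
Proof.
apply: (eq_mx_bvec nwords_uniq) => s sN; rewrite bvec_gmx ?nwords_uniq //.
rewrite feval_flatten mulmx_sumr big_seq [RHS]big_seq; apply: eq_bigr => c.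
rewrite mem_iota => /= c4; rewrite mulmxA bvec_gmx ?nwords_uniq // feval_gmx ?nwords_uniq //.
exact: dif_supp.
Qed.

Lemma euler_supp s : s \in nwords -> fsupp [in nwords] (euler s).
Proof.
move=> sN; apply/allP => u /flattenP[p /mapP[c]].
rewrite mem_iota => c4 -> {p}; move: u; apply/allP.
by apply: fsupp_ext (dif_supp c4 sN) _ => t; apply: lmul_in.
Qed.

Lemma nfvec_normal s : s \in nwords -> nfvec s = bv s.
Proof.
elim: s => //= a s IH /nwords_suffix[sN Las].
by rewrite IH // bvec_gmx ?nwords_uniq // Las feval1.
Qed.

Lemma nword_in j : nword j \in nwords.
Proof. exact: (mem_tnth j (in_tuple nwords)). Qed.

Lemma nfvec_size s j : all (fun a => a < 4)%N s ->
  size (nword j) != size s -> nfvec s 0 j = 0.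
Proof.
elim: s j => [|a s IH] j /= => [_|/andP[a4 s4]] js.
  by rewrite mxE; case: (tnth _ j) js.
rewrite mxE big1 // => i _; case: (eqVneq (size (nword i)) (size s)).
  move=> it.
  rewrite mxE /feval summxE big_seq big1 ?mulr0 // => t.
  move=> /(allP (lmul_supp a4 (nword_in i)))/andP[_ /eqP ts].
  rewrite mulmxzE mxE; case: eqP => [tj|]; last by rewrite mul0rz.
  by move: js; rewrite -tj ts it eqxx.
by move=> /(IH _ s4)->; rewrite mul0r.
Qed.

Hypothesis charH : forall k (x : H), x *+ k.+1 = 0 -> x = 0.

Lemma euler_cubic_pos m : (m < 9)%N -> exists k, (euler_cubic m.+1).2 = Posz k.+1.
Proof. by do 9?[case: m => [|m] //]; eexists; reflexivity. Qed.

Lemma nfvec_nondegenerate m (v : 'rV[H]_n) :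
    (forall j, size (nword j) != m.+1 -> v 0 j = 0) ->
    (forall c, (c < 4)%N -> v *m Dmx c = 0) ->
  v = 0.
Proof.
move=> vm vD; have uN := nwords_uniq.
have vE : v *m Emx = 0.
  rewrite gmx_euler mulmx_sumr big_seq big1 // => c; rewrite mem_iota => c4.
  by rewrite mulmxA vD // mul0mx.
(* Above degree 9 there is no normal word, so homogeneity alone gives [v = 0]. *)
have [m9|m9] := ltnP m 9; last first.
  apply/rowP => j; rewrite [RHS]mxE vm // neq_ltn.
  by rewrite (leq_trans (allP nwords_size _ (nword_in j))) // ltnS.
have [k kE] := euler_cubic_pos m9.
have [a [b abE]] : exists a b, euler_cubic m.+1 = (a, b, Posz k.+1).
  by case: (euler_cubic _) kE => [[a b] _] /= ->; exists a, b.
have cub : v *m Emx *m Emx *m Emx + (v *m Emx) *~ b =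
           (v *m Emx *m Emx) *~ a + v *~ (Posz k.+1).
  (* The cubic equation is linear in the vector, so its verification on normal words extends to
     every homogeneous [v]. *)
  have cubD (u : 'rV_n) (h : H) : u *m Emx *m Emx *m Emx + (u *m Emx) *~ b =
      (u *m Emx *m Emx) *~ a + u *~ (Posz k.+1) ->
      (h *: u) *m Emx *m Emx *m Emx + ((h *: u) *m Emx) *~ b =
      ((h *: u) *m Emx *m Emx) *~ a + (h *: u) *~ (Posz k.+1).
    by move=> e; rewrite -!scalemxAl !scalerMzr -!scalerDr e.
  rewrite [v]row_sum_delta !mulmx_suml !mulrz_suml -!big_split /=.
  apply: eq_bigr => j _; case: (eqVneq (size (nword j)) m.+1) => jm; last first.
    by rewrite vm // !scale0r !mul0mx !mul0rz.
  apply: cubD; rewrite -(bvec_tnth H uN).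
  have jN := nword_in j; have := @euler_cubicP (nword j) (nword_in j).
  rewrite -size_eq0 jm => /(_ isT); rewrite abE => /(feval_eq bv).
  rewrite !feval_cat !feval_scale feval1.
  have eN := euler_supp (nword_in j).
  have eeN := fsupp_ext eN euler_supp.
  by rewrite -!(feval_gmx H uN) // !(bvec_gmx H uN).
(* All terms containing S vanish at [v]; only the constant term survives. *)
have: v *+ k.+1 = 0.
  by move: cub; rewrite vE !mul0mx !mul0rz !add0r => /esym.
move=> /rowP vk; apply/rowP => j; have := vk j; rewrite [RHS]mxE mulmxnE.
by move=> /charH ->; rewrite mxE.
Qed.

End NormalForm.

(** * Skew derivations and the kernel of the antisymmetrizers *)

Section Derivations.
Local Open Scope ring_scope.
Variables (F : fieldType) (G : finGroupType) (c : G).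

Local Notation H := {ffun G -> F}.
Local Notation X := (class_elt c).
Local Notation T m := (tpow F c m).
Local Notation word m := (m.-tuple X).

Lemma ad_inj (a : X) : injective (ad a).
Proof. by move=> b d /(congr1 val) /= /mulIg /mulgI /val_inj. Qed.

(** Unlike the tensor product with e_a on the left, this does not translate the coefficients by R_a,
    and is therefore linear over H. *)
Definition acons m (a : X) (u : T m) : T m.+1 :=
  [ffun w => if thead w == a then u (behead_tuple w) else 0].

Definition slice m (a : X) (u : T m.+1) : T m := [ffun w => u (cons_tuple a w)].

Lemma acons_linear m a : linear (@acons m a).
Proof.
by move=> h u v; apply/ffunP => w; rewrite !ffunE; case: ifP => // _; rewrite scaler0 addr0.
Qed.

HB.instance Definition _ m a :=
  GRing.isLinear.Build H (T m) (T m.+1) _ (@acons m a) (@acons_linear m a).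

Lemma slice_linear m a : linear (@slice m a).
Proof. by move=> h u v; apply/ffunP => w; rewrite !ffunE. Qed.

HB.instance Definition _ m a :=
  GRing.isLinear.Build H (T m.+1) (T m) _ (@slice m a) (@slice_linear m a).

HB.instance Definition _ j i m :=
  GRing.isLinear.Build H (T m) (T m) _ (@Psi_chain F G c j i m) (@Psi_chain_linear F G c j i m).

HB.instance Definition _ j i m :=
  GRing.isLinear.Build H (T m) (T m) _ (@braided_int F G c j i m) (@braided_int_linear F G c j i m).

Lemma slice_acons m a b (u : T m) : slice b (acons a u) = if b == a then u else 0.
Proof.
apply/ffunP => w; rewrite !ffunE theadE; case: eqP => _; last by rewrite ffunE.
by congr (u _); apply: val_inj.
Qed.

Lemma acons_slice m (u : T m.+1) : u = \sum_a acons a (slice a u).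
Proof.
apply/ffunP => w; rewrite sum_ffunE (bigD1 (thead w)) //= big1 ?addr0.
  by rewrite !ffunE eqxx; congr (u _); rewrite {1}[w]tuple_eta.
by move=> a aw; rewrite ffunE eq_sym (negPf aw).
Qed.

Lemma slice_inj m (u v : T m.+1) : (forall a, slice a u = slice a v) -> u = v.
Proof.
by move=> uv; rewrite [u]acons_slice [v]acons_slice; apply: eq_bigr => a _; rewrite uv.
Qed.

Lemma acons_tbasis m a (w : word m) : acons a (tbasis F w) = tbasis F (cons_tuple a w).
Proof.
apply/ffunP => v; rewrite !ffunE [in RHS](tuple_eta v).
rewrite -[in RHS]val_eqE /= eqseq_cons -[behead v == w]/(val (behead_tuple v) == val w) val_eqE.
by case: eqP.
Qed.

Lemma tpow_linear_ext m (V : lmodType H) (f g : {linear T m -> V}) :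
  (forall w, f (tbasis F w) = g (tbasis F w)) -> f =1 g.
Proof.
move=> fg u; rewrite [u]tpowE !linear_sum; apply: eq_bigr => w _.
by rewrite !linearZ /= fg.
Qed.

Lemma acons_linear_ext m (V : lmodType H) (f g : {linear T m.+1 -> V}) :
  (forall a u, f (acons a u) = g (acons a u)) -> f =1 g.
Proof. by move=> fg u; rewrite [u]acons_slice !linear_sum; apply: eq_bigr. Qed.

Lemma Psi_acons i m a (u : T m) : Psi i.+1 (acons a u) = acons a (Psi i u).
Proof.
apply: (@tpow_linear_ext _ _ (@Psi F G c i.+1 m.+1 \o acons a)
                       (acons a \o @Psi F G c i m)) => w /=.
rewrite Psi_tbasis !acons_tbasis Psi_tbasis; congr tbasis; exact: val_inj.
Qed.

Lemma Psi0_acons m a b (u : T m) :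
  Psi 0 (acons a (acons b u)) = acons (ad a b) (acons a u).
Proof.
apply: (@tpow_linear_ext _ _ (@Psi F G c 0 m.+2 \o (acons a \o acons b))
                       (acons (ad a b) \o @acons m a)) => w /=.
rewrite !acons_tbasis Psi_tbasis; congr tbasis; exact: val_inj.
Qed.

Lemma Psi_chain_acons j i m a (u : T m) :
  Psi_chain j.+1 i (acons a u) = acons a (Psi_chain j i u).
Proof.
rewrite /Psi_chain -[j.+1]addn1 addnC iotaDl; elim: (iota j i) => //= l s ->.
exact: Psi_acons.
Qed.

Lemma braided_int_acons j k m a (u : T m) :
  braided_int j.+1 k (acons a u) = acons a (braided_int j k u).
Proof.
rewrite /braided_int linear_sum; apply: eq_bigr => i _.
by rewrite linearZ /= Psi_chain_acons.
Qed.

Lemma slice_braided_int j k m a (u : T m.+1) :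
  slice a (braided_int j.+1 k u) = braided_int j k (slice a u).
Proof.
apply: (@acons_linear_ext _ _ (slice a \o @braided_int F G c j.+1 k m.+1)
                        (@braided_int F G c j k m \o slice a)) => b {}u /=.
by rewrite braided_int_acons !slice_acons; case: eqP => // _; rewrite linear0.
Qed.

Definition deriv a m (u : T m.+1) : T m := slice a (braided_int 0 m.+1 u).

(** The last factor of the product is [m+2, -Psi]; it is applied first and is the only one that
    touches the first place. *)
Lemma antisymS m (u : T m.+2) : antisym u =
  foldr (fun k f => braided_int (m.+2 - k) k (m := m.+2) \o f)
    idfun (iota 2 m) (braided_int 0 m.+2 u).
Proof.
rewrite /antisym -[m.+2.-1]addn1 iotaD foldr_cat /= subnn.
by elim: (iota 2 m) => [//|k s IH] /=; rewrite IH.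
Qed.

Lemma slice_antisym a m (u : T m.+1) : slice a (antisym u) = antisym (deriv a u).
Proof.
case: m u => [|m] u.
  by rewrite /antisym /deriv /braided_int big_ord1 scale1r.
rewrite antisymS /deriv /antisym /=.
have : all (fun k => k <= m.+1)%N (iota 2 m).
  by apply/allP => k; rewrite mem_iota add2n => /andP[_].
elim: (iota 2 m) => //= k s IH /andP[km /IH <-].
by rewrite subSn // slice_braided_int.
Qed.

Lemma antisym_eq0 m (u : T m.+1) :
  (antisym u = 0) <-> (forall a, antisym (deriv a u) = 0).
Proof.
split=> [u0 a|u0]; first by rewrite -slice_antisym u0 linear0.
by apply: slice_inj => a; rewrite slice_antisym u0 linear0.
Qed.

(** Every term except the identity begins with Psi_12, and what follows leaves the first place
    alone: [m+2, -Psi] = id - Psi_12 (id (x) [m+1, -Psi]). *)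
Lemma braided_int0 a m (u : T m.+1) :
  braided_int 0 m.+2 (acons a u) = acons a u - Psi 0 (acons a (braided_int 0 m.+1 u)).
Proof.
rewrite /braided_int big_ord_recl /= scale1r; congr (_ + _).
rewrite (linear_sum (@acons m.+1 a)) (linear_sum (@Psi F G c 0 m.+2)) -sumrN; apply: eq_bigr => i _.
rewrite /Psi_chain /= -/(Psi_chain 1 i _) Psi_chain_acons linearZ /= linearZ /=.
by rewrite exprS mulN1r scaleNr.
Qed.

(** Psi_12 moves e_a to the second place and replaces a following e_b by e_(aba^-1) in the first, so
    the slice at aba^-1 of the braided term comes from the slice at b. *)
Lemma deriv_acons a b m (u : T m.+1) :
  deriv (ad a b) (acons a u) = (if ad a b == a then u else 0) - acons a (deriv b u).
Proof.
rewrite /deriv braided_int0 linearB /= slice_acons; congr (_ - _).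
move: (braided_int _ _ u).
apply: (@acons_linear_ext _ _ (slice (ad a b) \o (@Psi F G c 0 m.+2 \o acons a))
                        (acons a \o slice b)) => d y /=.
rewrite Psi0_acons !slice_acons (inj_eq (@ad_inj a)).
by case: eqP => // _; rewrite linear0.
Qed.

Lemma deriv_acons0 a b (u : T 0) : deriv b (acons a u) = if b == a then u else 0.
Proof. by rewrite /deriv /braided_int big_ord1 scale1r slice_acons. Qed.

Section Eval.
Variables (V : lmodType H) (f : seq X -> V).

Definition tev m (u : T m) : V := \sum_(w : word m) (u w : H) *: f w.

Lemma tev_linear m : linear (@tev m).
Proof.
move=> h u v; rewrite /tev scaler_sumr -big_split /=; apply: eq_bigr => w _.
by rewrite !ffunE scalerDl scalerA.
Qed.

HB.instance Definition _ m :=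
  GRing.isLinear.Build H (T m) V _ (@tev m) (@tev_linear m).

Lemma tev_tbasis m (w : word m) : tev (tbasis F w) = f w.
Proof.
rewrite /tev (bigD1 w) //= big1 => [|v vw]; rewrite !ffunE ?eqxx ?scale1r ?addr0 //.
by rewrite (negPf vw) scale0r.
Qed.

End Eval.

Lemma tev_acons (V : lmodType H) (f : seq X -> V) m a (u : T m) :
  tev f (acons a u) = tev (f \o cons a) u.
Proof.
apply: (@tpow_linear_ext _ _ (@tev V f m.+1 \o acons a) (@tev V (f \o cons a) m)) => w /=.
by rewrite acons_tbasis !tev_tbasis.
Qed.

(** * Normal forms of tensors *)

Variable code : X -> nat.
Hypothesis code_inj : injective code.
Hypothesis code_lt : forall a, (code a < 4)%N.
Hypothesis code_surj : forall n, (n < 4)%N -> exists a, code a = n.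
Hypothesis code_ad : forall a b, code (ad a b) = rack (code a) (code b).
Hypothesis charF : [pchar F] =i pred0.

Definition nform m : T m -> 'rV[H]_(size nwords) := tev (fun s => nfvec H (map code s)) (m := m).
HB.instance Definition _ m := GRing.Linear.on (@nform m).

Lemma nform_acons m a (u : T m) :
  nform (acons a u) = nform u *m gmx H nwords (lmul (code a)).
Proof.
rewrite /nform tev_acons /tev mulmx_suml; apply: eq_bigr => w _.
by rewrite -scalemxAl.
Qed.

Lemma ad_surj (a b : X) : exists d, b = ad a d.
Proof.
have [d dE] := code_surj (rackV_lt (code_lt a) (code_lt b)); exists d.
by apply/code_inj/esym/eqP; rewrite code_ad rackK // dE.
Qed.

(** Both sides obey the same skew Leibniz rule, [deriv_acons] for tensors and [gmx_lmul_dif] in B,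
    which gives an induction on the degree. *)
Lemma nform_deriv m a (u : T m.+1) :
  nform (deriv a u) = nform u *m gmx H nwords (dif (code a)).
Proof.
elim: m a u => [|m IH] b;
  apply: (@acons_linear_ext _ _ (@nform _ \o (slice b \o @braided_int F G c 0 _ _))
            (mulmxr (gmx H nwords (dif (code b))) \o @nform _)) => a u /=;
  rewrite -/(deriv b _) nform_acons -mulmxA gmx_lmul_dif // mulmxBr mulmxA (inj_eq code_inj).
  (* In degree 1 the tail is a scalar multiple of the empty word, which every derivation kills. *)
  have -> : nform u *m gmx H nwords (dif (rackV (code a) (code b))) = 0.
    rewrite /nform /tev mulmx_suml big1 // => w _; rewrite tuple0 -scalemxAl.
    by rewrite gmx_dif_nil scaler0.
  rewrite mul0mx subr0 deriv_acons0 eq_sym.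
  by case: eqP => _; rewrite ?mulmx1 // linear0 raddf0 mulmx0.
have [d ->] := ad_surj a b.
rewrite deriv_acons linearB /= nform_acons IH.
have -> : rackV (code a) (code (ad a d)) = code d.
  by apply/esym/eqP; rewrite -rackK // code_ad.
by rewrite eq_sym; case: eqP => _; rewrite ?mulmx1 // linear0 raddf0 mulmx0.
Qed.

Lemma ffun_charP k (x : H) : x *+ k.+1 = 0 -> x = 0.
Proof.
move=> /ffunP x0; apply/ffunP => g; have := x0 g; rewrite ffunMnE ffunE -mulr_natr.
move=> /eqP; rewrite mulf_eq0 => /orP[/eqP //|].
by rewrite (pcharf0P F).1.
Qed.

Lemma nform_size m (u : T m) j : size (nword j) != m -> nform u 0 j = 0.
Proof.
move=> jm; rewrite /nform /tev summxE big1 // => w _; rewrite mxE nfvec_size ?mulr0 //.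
  by apply/allP => _ /mapP[a _ ->].
by rewrite size_map size_tuple.
Qed.

(** Induction on the degree: [antisym_eq0] passes to the derivatives of [u], [nform_deriv] turns
    these into the operators D_a on B, and nondegeneracy returns to [nform u]. *)
Lemma antisym_nform m (u : T m) : antisym u = 0 <-> nform u = 0.
Proof.
elim: m u => [|m IH] u.
  have -> : nform u = u [tuple] *: bvec H nwords [::].
    by rewrite /nform /tev (big_pred1 [tuple]) // => w; apply/esym/eqP; exact: tuple0.
  split=> [u0|/rowP]; first by rewrite [u]u0 ffunE scale0r.
  have [j jE] := in_tnth nil_nwords.
  move=> /(_ j); rewrite !mxE jE eqxx mulr1 => u0.
  by apply/ffunP => w; rewrite tuple0 u0 ffunE.
rewrite antisym_eq0; split=> [u0|u0 a]; last by apply/IH; rewrite nform_deriv u0 mul0mx.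
apply: (nfvec_nondegenerate ffun_charP (m := m)) => [j|d d4].
  exact: nform_size.
by have [a <-] := code_surj d4; rewrite -nform_deriv; apply/IH.
Qed.


(** * The ideal generated in degree 2 *)

(** Psi has cube the identity in degree 2. For a word aa, fixed by Psi, the sum is three times that
    word. *)
Definition orbit_sum (b : word 2) : T 2 :=
  tbasis F b + tbasis F (braid_word 0 b) + tbasis F (braid_word 0 (braid_word 0 b)).

Definition orbrel p q (x : word p) (b : word 2) (y : word q) : T (p + (2 + q)) :=
  tensp (tbasis F x) (tensp (orbit_sum b) (tbasis F y)).

Lemma orbrelE p q (x : word p) b (y : word q) : orbrel x b y =
  tbasis F (cat_tuple x (cat_tuple b y))
  + tbasis F (cat_tuple x (cat_tuple (braid_word 0 b) y))
  + tbasis F (cat_tuple x (cat_tuple (braid_word 0 (braid_word 0 b)) y)).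
Proof. by rewrite /orbrel /orbit_sum !tensp_Dl !tensp_Dr !tensp_tbasis. Qed.

Lemma ker_antisym2 (r : T 2) : (r \in @ker_antisym F G c 2) = (Psi 0 r == r).
Proof.
rewrite ker_antisymE /antisym /= /braided_int !big_ord_recl big_ord0 /=.
by rewrite addr0 /Psi_chain /= scale1r expr1 scaleN1r subr_eq0 eq_sym.
Qed.

(** A special property of this rack, false in general conjugacy classes; it makes Psi^3 the identity
    on words of length 2. *)
Lemma ad_ad (a b : X) : ad (ad a b) a = b.
Proof.
apply: code_inj; rewrite !code_ad.
by case: (code a) (code b) (code_lt a) (code_lt b) => [|[|[|[|?]]]] // [|[|[|[|?]]]].
Qed.

Lemma braid_word3 (b : word 2) :
  braid_word 0 (braid_word 0 (braid_word 0 b)) = b.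
Proof.
apply: val_inj; case: b => [[|x [|y []]] //= _].
by rewrite !ad_ad.
Qed.

Lemma orbit_ker b : orbit_sum b \in @ker_antisym F G c 2.
Proof.
rewrite ker_antisym2 /orbit_sum !raddfD /= !Psi_tbasis braid_word3.
by rewrite addrC addrA.
Qed.

Lemma deg2_orbrel p q (x : word p) b (y : word q) : deg2_generated (orbrel x b y).
Proof. exact/deg2_gen/orbit_ker. Qed.

Lemma deg2_scale m h (u : T m) : deg2_generated u -> deg2_generated (h *: u).
Proof.
elim=> {m u} [p q u r v rk|m|m u v _ Du _ Dv].
- by rewrite -tensp_Zl; apply: deg2_gen.
- by rewrite scaler0; apply: deg2_zero.
by rewrite scalerDr; apply: deg2_add.
Qed.

(** Psi preserves the product of the letters in G, so all three words translate [f] in the same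
    way. *)
Lemma orbit_ract b f : Defs.ract (orbit_sum b) f = rtrans (wprod b) f *: orbit_sum b.
Proof. by rewrite /orbit_sum !ractDl !ract_tbasis !wprod_braid !scalerDr. Qed.

(** Since Psi r = r, expanding r, Psi r and Psi^2 r on words and adding them turns each word into
    its orbit sum. *)
Lemma ker_orbit (r : T 2) : r \in @ker_antisym F G c 2 ->
  r *+ 3 = \sum_b (r b : H) *: orbit_sum b.
Proof.
rewrite ker_antisym2 => /eqP Pr; rewrite mulrS mulr2n addrA.
have Pr1 : r = \sum_b (r b : H) *: tbasis F (braid_word 0 b) by rewrite -{1}Pr.
have Pr2 : r = \sum_b (r b : H) *: tbasis F (braid_word 0 (braid_word 0 b)).
  rewrite -{1}Pr {1}Pr1 (raddf_sum (@Psi F G c 0 2)); apply: eq_bigr => b _.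
  by rewrite /= Psi_Z Psi_tbasis.
rewrite {1}[r]tpowE {2}Pr1 {3}Pr2 -!big_split /=; apply: eq_bigr => b _.
by rewrite !scalerDr.
Qed.

Lemma third n (z : T n) : z = [ffun=> 3%:R^-1 : F] *: (z *+ 3).
Proof.
rewrite -scalerMnr scalerMnl -[LHS]scale1r; congr (_ *: _).
apply/ffunP => g; rewrite ffunMnE !ffunE -[RHS]mulr_natr mulVf //.
by rewrite (pcharf0P F).1.
Qed.

(** Dividing by 3 and moving all coefficients to the left reduces the ideal to H-combinations of
    orbit sums placed between words. *)
Lemma deg2_orbit_ind (P : forall m, T m -> Prop) :
    (forall m, P m 0) -> (forall m u v, P m u -> P m v -> P m (u + v)) ->
    (forall m h u, P m u -> P m (h *: u)) ->
    (forall p q (x : word p) b (y : word q), P _ (orbrel x b y)) ->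
  forall m (u : T m), deg2_generated u -> P m u.
Proof.
move=> P0 PD PZ Porb m u; elim=> {m u} // [p q u r v /ker_orbit r3|m u v _ Pu _ Pv];
  last exact: PD.
have PS m I (s : seq I) (E : I -> T m) : (forall i, P m (E i)) -> P m (\sum_(i <- s) E i).
  by move=> PE; apply: (big_ind (P m)) => //; apply: PD.
have tr n k (w : T n) : tensp w (0 : T k) = 0.
  by apply: (addrI (tensp w 0)); rewrite -tensp_Dr !addr0.
have tl n k (w : T k) : tensp (0 : T n) w = 0.
  by apply: (addrI (tensp 0 w)); rewrite -tensp_Dl !addr0.
have sl n k (w : T k) := big_morph _ (@tensp_Dl F G c n k w) (tl n k w).
have sr n k (w : T n) := big_morph _ (@tensp_Dr F G c n k w) (tr n k w).
rewrite [tensp _ _]third; apply: (PZ).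
have -> : tensp u (tensp r v) *+ 3 = tensp u (tensp (r *+ 3) v).
  by rewrite !mulrS !mulr0n !addr0 !tensp_Dl !tensp_Dr.
rewrite {}r3 [u]tpowE !sl; apply: (PS) => a; rewrite tensp_Zl; apply: (PZ).
rewrite sr; apply: (PS) => b.
rewrite tensp_Zl [v]tpowE !sr scaler_sumr sr; apply: (PS) => d.
rewrite -[tensp (orbit_sum b) _]tensp_balanced orbit_ract tensp_Zl scalerA.
rewrite -tensp_balanced ract_tbasis tensp_Zl.
exact/PZ/Porb.
Qed.

(** As [acons] is not the tensor product by e_a, closure of the ideal under it is proved on the
    orbit relations, where no coefficient occurs. *)
Lemma deg2_acons m a (u : T m) : deg2_generated u -> deg2_generated (acons a u).
Proof.
move: m u; apply: deg2_orbit_ind => [m|m u v Du Dv|m h u Du|p q x b y].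
- by rewrite linear0; apply: deg2_zero.
- by rewrite linearD; apply: deg2_add.
- by rewrite linearZ; apply: deg2_scale.
have -> : acons a (orbrel x b y) = orbrel (cons_tuple a x) b y.
  rewrite !orbrelE !linearD /= !acons_tbasis.
  by congr (tbasis _ _ + tbasis _ _ + tbasis _ _); apply: val_inj.
exact (deg2_orbrel (cons_tuple a x) b y).
Qed.

Lemma tev_deg2 (V : lmodType H) (f : seq X -> V) :
    (forall x y a b, f (x ++ [:: a, b & y]) + f (x ++ [:: ad a b, a & y])
        + f (x ++ [:: b, ad a b & y]) = 0) ->
  forall m (u : T m), deg2_generated u -> tev f u = 0.
Proof.
move=> f0; apply: deg2_orbit_ind => [m|m u v u0 v0|m h u u0|p q x b y].
- by rewrite linear0.
- by rewrite linearD /= u0 v0 addr0.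
- by rewrite linearZ /= u0 scaler0.
rewrite orbrelE !linearD /= !tev_tbasis /=.
by case: b => [[|a [|b []]] //= _]; rewrite ad_ad f0.
Qed.


(** * Rewriting modulo the quadratic ideal up to degree 5 *)

Definition letters m (s : seq nat) := (size s == m) && all (fun a => a < 4)%N s.

(** This is zero when [s] has the wrong length or a letter outside 0, ..., 3. *)
Definition tword m (s : seq nat) : T m := [ffun w : word m => (map code w == s)%:R].

Lemma tbasis_tword m (w : word m) : tbasis F w = tword m (map code w).
Proof. by apply/ffunP => v; rewrite !ffunE (inj_eq (inj_map code_inj)) val_eqE. Qed.

Lemma letters_map m (w : word m) : letters m (map code w).
Proof.
by rewrite /letters size_map size_tuple eqxx; apply/allP => _ /mapP[a _ ->].
Qed.

Lemma letters_word m s : letters m s -> exists w : word m, s = map code w.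
Proof.
elim: s m => [|n s IH] [|m] //=; first by exists [tuple].
rewrite /letters /= eqSS => /and3P[sm /code_surj[a <-] s4].
have [|w ->] := IH m; first by rewrite /letters sm.
by exists (cons_tuple a w).
Qed.

Lemma acons_tword m a s : acons a (tword m s) = tword m.+1 (code a :: s).
Proof.
apply/ffunP => w; rewrite !ffunE [in RHS](tuple_eta w) /= eqseq_cons (inj_eq code_inj).
by case: eqP.
Qed.

Lemma deg2_opp m (u : T m) : deg2_generated u -> deg2_generated (- u).
Proof. by rewrite -scaleN1r; apply: deg2_scale. Qed.

Lemma deg2_trans m (u v w : T m) :
  deg2_generated (u - v) -> deg2_generated (v - w) -> deg2_generated (u - w).
Proof. by move=> uv vw; rewrite -(subrKA v); apply: deg2_add. Qed.

Lemma deg2_sum m I (s : seq I) (E : I -> T m) :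
  (forall i, deg2_generated (E i)) -> deg2_generated (\sum_(i <- s) E i).
Proof.
by move=> DE; apply: (big_ind (@deg2_generated F G c m)) => //;
  [apply: deg2_zero | apply: deg2_add].
Qed.

Lemma deg2_feval m (K : eqType) (P : pred K) (f g : K -> T m) p :
    fsupp P p -> (forall s, P s -> deg2_generated (f s - g s)) ->
  deg2_generated (feval f p - feval g p).
Proof.
move=> /allP Pp fg; rewrite /feval -sumrB big_seq_cond big_mkcond /=.
apply: deg2_sum => -[k s]; rewrite andbT; case: ifP => [/Pp/fg|_]; last exact: deg2_zero.
by rewrite -mulrzBl -scaler_int; apply: deg2_scale.
Qed.

Lemma deg2_quad m a b s : (a < 4)%N -> (b < 4)%N -> letters m s ->
  deg2_generated (tword m.+2 [:: a, b & s] + tword m.+2 [:: rack a b, a & s]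
                  + tword m.+2 [:: b, rack a b & s]).
Proof.
move=> /code_surj[x <-] /code_surj[y <-] /letters_word[w ->].
have := deg2_orbrel [tuple] [tuple x; y] w; rewrite orbrelE !tbasis_tword /=.
by rewrite ad_ad code_ad.
Qed.

Lemma deg2_square m a s : (a < 4)%N -> letters m s ->
  deg2_generated (tword m.+2 [:: a, a & s]).
Proof.
move=> a4 sm; rewrite [tword _ _]third; apply: deg2_scale.
have := deg2_quad a4 a4 sm.
have -> : rack a a = a by case: a a4 => [|[|[|[|]]]].
by rewrite !mulrS mulr0n addr0 addrA.
Qed.

(** With x = [rack a b] and r = ab + xa + bx, one has bab - aba = b r - r a - (bb) x + x (aa). *)
Lemma deg2_braid m a b s : (a < 4)%N -> (b < 4)%N -> letters m s ->
  deg2_generated (tword m.+3 [:: b, a, b & s] - tword m.+3 [:: a, b, a & s]).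
Proof.
move=> a4 b4 sm; have x4 := rack_lt a4 b4.
have l1 d : (d < 4)%N -> letters m.+1 (d :: s) by move=> d4; rewrite /letters /= eqSS d4.
have left d t : (d < 4)%N -> deg2_generated (tword m.+2 t) ->
    deg2_generated (tword m.+3 (d :: t)).
  by move=> /code_surj[e <-] ?; rewrite -acons_tword; apply: deg2_acons.
have [y yb] := code_surj b4.
have := deg2_acons y (deg2_quad a4 b4 sm); rewrite !linearD /= !acons_tword yb => D1.
have D2 := deg2_opp (deg2_quad a4 b4 (l1 _ a4)).
have D3 := deg2_opp (deg2_square b4 (l1 _ x4)).
have D4 := left _ _ x4 (deg2_square a4 sm).
have cancel (A B C D E : T m.+3) : A + B + C - (D + E + B) + (- C + E) = A - D.
  rewrite (addrAC A B C) [D + E + B]addrC addrKA opprD.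
  by rewrite addrACA addrK subrK.
by have := deg2_add (deg2_add D1 D2) (deg2_add D3 D4); rewrite cancel.
Qed.

Lemma quad_rules_sound r m s : r \in quad_rules -> letters m s ->
  deg2_generated (tword (size r.1 + m)%N (r.1 ++ s)
    - feval (fun t => tword (size r.1 + m)%N (t ++ s)) r.2).
Proof.
move=> rR sm.
have quad a b : (a < 4)%N -> (b < 4)%N -> deg2_generated (tword m.+2 [:: rack a b, a & s]
    - feval (fun t => tword m.+2 (t ++ s))
        [:: (Negz 0, [:: b; rack a b]); (Negz 0, [:: a; b])]).
  move=> a4 b4; rewrite feval_cons feval1 /= !NegzE !mulrN1z opprD !opprK.
  by rewrite addrA addrC addrA; apply: deg2_quad.
have square a : (a < 4)%N -> deg2_generated (tword m.+2 [:: a, a & s]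
    - feval (fun t => tword m.+2 (t ++ s)) [::]).
  by move=> a4; rewrite feval_nil subr0; apply: deg2_square.
have braid a b : (a < 4)%N -> (b < 4)%N -> deg2_generated (tword m.+3 [:: b, a, b & s]
    - feval (fun t => tword m.+3 (t ++ s)) [:: (1%R, [:: a; b; a])]).
  by move=> a4 b4; rewrite feval1 mulr1z; apply: deg2_braid.
(* The twelve pairs of distinct letters form four orbits of Psi, one for each rule of [quad]
   type. *)
move: rR; rewrite !inE.
case/or4P => [|||/or4P[|||/or4P[|||]]] /eqP -> /=.
- exact: (square 0).
- exact: (square 1).
- exact: (square 2).
- exact: (square 3).
- exact: (quad 0 1).
- exact: (quad 0 2).
- exact: (quad 1 0).
- exact: (quad 2 1).
- exact: (braid 0 1).
- exact: (braid 1 2).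
Qed.

Lemma head_rulesP s r : r \in head_rules s -> r \in rules /\ s = r.1 ++ drop (size r.1) s.
Proof.
by rewrite mem_filter prefixE => /andP[/eqP tr ->]; rewrite -{1}tr cat_take_drop.
Qed.

Lemma letters_drop k m s : letters m s -> letters (m - k)%N (drop k s).
Proof.
rewrite /letters size_drop => /andP[/eqP<- s4]; rewrite eqxx /=.
by apply/allP => a /mem_drop; apply: (allP s4).
Qed.

Lemma rules_letters : all (fun r => fsupp (letters (size r.1)) r.2) rules.
Proof. by []. Qed.

Lemma chain_letters (f : nat -> seq nat -> seq (int * seq nat)) k t p :
    (forall a m s, (a < 4)%N -> letters m s -> fsupp (letters m.+1) (f a s)) ->
    all (fun a => a < 4)%N t -> fsupp (letters k) p ->
  fsupp (letters (size t + k)%N) (chain f t p).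
Proof.
move=> fl; elim: t => //= a t IH /andP[a4 /IH tl] /tl {}tl.
by apply: fsupp_ext tl _ => s; apply: fl.
Qed.

Lemma lmul_rec_letters n a m s : (a < 4)%N -> letters m s ->
  fsupp (letters m.+1) (lmul_rec n a s).
Proof.
elim: n a m s => [|n IH] a m s a4 sm.
  by rewrite /= andbT /letters /= eqSS a4.
rewrite /=; case E: (head_rules (a :: s)) => [|r rs].
  by rewrite /= andbT /letters /= eqSS a4.
have [|rR sE] := @head_rulesP (a :: s) r; first by rewrite E inE eqxx.
have asm : letters m.+1 (a :: s) by rewrite /letters /= eqSS a4.
have /(letters_drop (size r.1)) := asm; set s' := drop _ _ => s'm.
have rm : (size r.1 <= m.+1)%N.
  by case/andP: asm => /eqP <- _; rewrite sE size_cat leq_addr.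
apply: fsupp_ext (allP rules_letters _ rR) _ => t /andP[/eqP tr t4].
rewrite -(subnKC rm) -tr; apply: chain_letters => //; rewrite ?tr.
by rewrite /= andbT.
Qed.

Lemma chain_sound n k t s p : (size t + k <= 5)%N ->
    (forall a m s, (m < 5)%N -> (a < 4)%N -> letters m s ->
      deg2_generated (tword m.+1 (a :: s) - feval (tword m.+1) (lmul_rec n a s))) ->
    all (fun a => a < 4)%N t -> fsupp (letters k) p ->
    deg2_generated (tword k s - feval (tword k) p) ->
  deg2_generated (tword (size t + k)%N (t ++ s)
                  - feval (tword (size t + k)%N) (chain (lmul_rec n) t p)).
Proof.
move=> + fs; elim: t => //= a t IH t5 /andP[a4 t4] pk sp.
have {IH} := IH (ltnW t5) t4 pk sp.
have := chain_letters (@lmul_rec_letters n) t4 pk.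
move: (chain _ t p) (t ++ s) => {sp pk}p {}s pk sp.
have [x xa] := code_surj a4.
have /= := deg2_acons x sp; rewrite linearB /= acons_tword xa => /deg2_trans; apply.
rewrite (raddf_feval (@acons _ x)) feval_ext.
apply: deg2_feval pk _ => u um /=.
by rewrite acons_tword xa; apply: fs.
Qed.

(** Any fuel will do, since stopping early returns the word itself. *)
Lemma lmul_rec_sound n a m s : (m < 5)%N -> (a < 4)%N -> letters m s ->
  deg2_generated (tword m.+1 (a :: s) - feval (tword m.+1) (lmul_rec n a s)).
Proof.
elim: n a m s => [|n IH] a m s m5 a4 sm.
  by rewrite /= feval1 subrr; apply: deg2_zero.
rewrite [lmul_rec _ _ _]/=; case E: (head_rules (a :: s)) => [|r rs].
  by rewrite feval1 subrr; apply: deg2_zero.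
have [|rR sE] := @head_rulesP (a :: s) r; first by rewrite E inE eqxx.
have asm : letters m.+1 (a :: s) by rewrite /letters /= eqSS a4.
have /(letters_drop (size r.1)) := asm; move: sE; set s' := drop _ _ => sE s'm.
have rm : (size r.1 <= m.+1)%N.
  by case/andP: asm => /eqP <- _; rewrite sE size_cat leq_addr.
(* The remaining rule has a left-hand side of length 6, too long for a word of length at most 5. *)
have rQ : r \in quad_rules.
  move: rR; rewrite mem_rcons inE => /orP[/eqP rE|//].
  by move: (leq_trans rm m5); rewrite rE.
have := quad_rules_sound rQ s'm; rewrite (subnKC rm) -sE => /deg2_trans; apply.
rewrite feval_ext; apply: deg2_feval (allP rules_letters _ rR) _ => t /andP[/eqP tr t4].
rewrite -(subnKC rm) -tr; apply: chain_sound => //; rewrite ?tr ?subnKC //.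
  by rewrite /= andbT.
by rewrite feval1 mulr1z subrr; apply: deg2_zero.
Qed.

(** * Ranks and additional relations *)

Local Notation n := (size nwords).

(** A linear section of [nform] in degree m: coordinates at words of other lengths are discarded
    because [tword] vanishes there. *)
Definition lift_nf m (v : 'rV[H]_n) : T m := \sum_j v 0 j *: tword m (nword j).

Lemma lift_nf_linear m : linear (@lift_nf m).
Proof.
move=> h u v; rewrite /lift_nf scaler_sumr -big_split /=; apply: eq_bigr => j _.
by rewrite !mxE scalerDl scalerA.
Qed.

HB.instance Definition _ m :=
  GRing.isLinear.Build H 'rV[H]_n (T m) _ (@lift_nf m) (@lift_nf_linear m).

Lemma lift_nf_bvec m s : s \in nwords -> lift_nf m (bvec H nwords s) = tword m s.
Proof.
move=> /in_tnth[i ->]; rewrite (bvec_tnth H nwords_uniq) /lift_nf (bigD1 i) //=.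
rewrite big1 ?addr0 => [|j ji]; rewrite mxE eqxx ?eqxx ?scale1r //=.
by rewrite (negPf ji) scale0r.
Qed.

Lemma nword_letters j : letters (size (nword j)) (nword j).
Proof. by rewrite /letters eqxx (allP nwords_letters) // (nword_in j). Qed.

Lemma nfvec_sound m s : (m <= 5)%N -> letters m s ->
  deg2_generated (tword m s - lift_nf m (nfvec H s)).
Proof.
elim: s m => [|a s IH] m m5 sm.
  by rewrite /= lift_nf_bvec ?nil_nwords // subrr; apply: deg2_zero.
case: m m5 sm => [|m] // m5; rewrite /letters /= eqSS => /and3P[sm /code_surj[x xa] s4].
have ls : letters m s by rewrite /letters sm.
have := deg2_acons x (IH m (ltnW m5) ls); rewrite linearB /= acons_tword xa => /deg2_trans; apply.
have -> : lift_nf m.+1 (nfvec H s *m gmx H nwords (lmul a)) =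
    \sum_j (nfvec H s) 0 j *: feval (tword m.+1) (lmul a (nword j)).
  rewrite mulmx_sum_row linear_sum; apply: eq_bigr => j _.
  have -> : row j (gmx H nwords (lmul a)) = feval (bvec H nwords) (lmul a (nword j)).
    exact: rowK.
  rewrite [LHS]linearZ; congr (_ *: _); rewrite [LHS](raddf_feval (@lift_nf m.+1)).
  have a4 : (a < 4)%N by rewrite -xa.
  apply: eq_feval (lmul_in a4 (nword_in j)) _ => t /=.
  exact: lift_nf_bvec.
rewrite /lift_nf linear_sum -sumrB; apply: deg2_sum => j.
rewrite linearZ /= -scalerBr acons_tword xa.
case: (eqVneq (size (nword j)) m) => jm; last first.
  by rewrite nfvec_size ?scale0r ?(eqP sm) //; apply: deg2_zero.
apply/deg2_scale/lmul_rec_sound => //; first by rewrite -xa.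
by rewrite -[m in letters m _]jm nword_letters.
Qed.

Lemma deg2_lift_nform m (u : T m) : (m <= 5)%N ->
  deg2_generated (u - lift_nf m (nform u)).
Proof.
move=> m5; rewrite {1}[u]tpowE /nform /tev (linear_sum (@lift_nf m)) -sumrB; apply: deg2_sum => w.
by rewrite linearZ /= -scalerBr tbasis_tword; apply/deg2_scale/nfvec_sound/letters_map.
Qed.

Lemma nform_tword m s : letters m s -> nform (tword m s) = nfvec H s.
Proof. by move=> /letters_word[w ->]; rewrite -tbasis_tword /nform tev_tbasis. Qed.

Local Notation pi m := (\pi_(@Quotient.quot (tpow F c m) (@ker_antisym F G c m)))%qT.

Lemma Omega_eq m (u v : T m) : (pi m u = pi m v) <-> nform u = nform v.
Proof.
have -> : (pi m u = pi m v) <-> antisym (u - v) = 0.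
  split=> [/eqP|uv]; first by rewrite -Quotient.idealrBE ker_antisymE => /eqP.
  by apply/eqP; rewrite -Quotient.idealrBE ker_antisymE uv.
rewrite antisym_nform linearB /=; split=> [/eqP|->]; last by rewrite subrr.
by rewrite subr_eq0 => /eqP.
Qed.

(** By [Omega_eq], [nform] embeds the quotient into row vectors. The normal words of length m are
    their own normal forms, so their classes form a basis. *)
Lemma Omega_free m : free_of_rank (Omega F c m) (count (fun s => size s == m) nwords).
Proof.
pose A := [pred j : 'I_n | size (nword j) == m].
have -> : count (fun s => size s == m) nwords = #|A|.
  by rewrite -sum1_card -sum1_count big_tnth.
pose b i : Omega F c m := pi m (tword m (nword (@enum_val _ A i))).
have piE (h : {ffun 'I_#|A| -> H}) : \sum_i h i *: b i =
    pi m (\sum_i h i *: tword m (nword (enum_val i))).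
  rewrite raddf_sum; apply: eq_bigr => i _; exact: Omega_scale_pi.
have nfE (h : {ffun 'I_#|A| -> H}) : nform (\sum_i h i *: tword m (nword (enum_val i))) =
    \sum_i h i *: delta_mx 0 (enum_val i).
  rewrite linear_sum; apply: eq_bigr => i _; rewrite linearZ /=; congr (_ *: _).
  have /eqP jm : size (nword (enum_val i)) == m := enum_valP i.
  rewrite nform_tword -?[m in letters m _]jm ?nword_letters //.
  by rewrite nfvec_normal ?(bvec_tnth H nwords_uniq) // (nword_in _).
exists b; elim/Omega_ind => u; exists [ffun i => nform u 0 (enum_val i)]; split.
  rewrite piE; apply/Omega_eq; rewrite nfE [LHS]row_sum_delta.
  rewrite (bigID A) /= [X in _ + X]big1 ?addr0 => [|j jm]; last by rewrite nform_size ?scale0r.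
  by rewrite big_enum_val; apply: eq_bigr => i _; rewrite ffunE.
move=> h; rewrite piE => /Omega_eq ->; rewrite nfE; apply/ffunP => i; rewrite ffunE.
rewrite summxE (bigD1 i) //= big1 => [|k ki]; rewrite !mxE eqxx ?eqxx ?mulr1 ?addr0 //=.
by rewrite (inj_eq enum_val_inj) eq_sym (negPf ki) mulr0.
Qed.

Lemma Omega_top m (w : Omega F c m) : (9 < m)%N -> w = 0.
Proof.
move=> m9; elim/Omega_ind: w => u; rewrite -[RHS](raddf0 (pi m)).
apply/Omega_eq; rewrite linear0; apply/rowP => j; rewrite nform_size ?mxE // neq_ltn.
apply/orP; left; apply: leq_trans m9.
exact: (allP nwords_size _ (nword_in j)).
Qed.

Lemma low_relations m (u : T m) : (m <= 5)%N -> antisym u = 0 -> deg2_generated u.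
Proof.
move=> m5 /antisym_nform u0; have := deg2_lift_nform u m5.
by rewrite u0 linear0 subr0.
Qed.

(** * A representation of the quadratic algebra detecting the additional relations *)

Local Notation actmx a := (gmx H states (state_act a)).
Local Notation sv := (bvec H states).

Definition state_vec (s : seq nat) : 'rV[H]_(size states) :=
  foldr (fun a v => v *m actmx a) (sv (false, 0%N)) s.

Lemma state_quad a b : (a < 4)%N -> (b < 4)%N ->
  actmx b *m actmx a + actmx a *m actmx (rack a b) + actmx (rack a b) *m actmx b = 0.
Proof.
move=> a4 b4; have x4 := rack_lt a4 b4.
apply: (eq_mx_bvec states_uniq) => s sS; rewrite mulmx0 !mulmxDr !mulmxA.
rewrite !(bvec_gmx _ states_uniq) // !(feval_gmx _ states_uniq) ?state_act_supp //.
by rewrite -addrA -!feval_cat (feval_eq _ (state_act_quad a4 b4 sS)) feval_nil.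
Qed.

Lemma tev_state_deg2 m (u : T m) :
  deg2_generated u -> tev (fun s => state_vec (map code s)) u = 0.
Proof.
move: m u; apply: tev_deg2 => x y a b; rewrite !map_cat /state_vec !foldr_cat.
rewrite !(foldr_mulmx _ _ (map code x)) -!mulmxDl /= -!mulmxA -!mulmxDr code_ad.
by rewrite state_quad ?code_lt // mulmx0 mul0mx.
Qed.

(** Each letter is the one that advances a state (false, n) to the next residue, so these words of
    every length reach a basis vector fixed by w. *)
Fixpoint cyc k : seq nat := if k is k'.+1 then (k %% 3)%N :: cyc k' else [::].

Lemma cyc_letters k : letters k (cyc k).
Proof.
elim: k => //= k; rewrite /letters /= eqSS => /andP[-> ->].
by rewrite andbT (leq_trans (ltn_pmod _ _)).
Qed.

Lemma state_vec_cyc k : state_vec (cyc k) = sv (false, k %% 3)%N.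
Proof.
elim: k => //= k ->; rewrite (bvec_gmx _ states_uniq); last first.
  by rewrite !inE; case: (k %% 3)%N (ltn_pmod k (isT : 0 < 3)%N) => [|[|[|]]].
rewrite /state_act /=.
have -> : ((k %% 3).+1 %% 3 = k.+1 %% 3)%N by rewrite -addn1 modnDml addn1.
by rewrite eqxx feval1 mulr1z.
Qed.

Lemma sixth_letters : all (letters 6) sixth_words.
Proof. by []. Qed.

Definition sixth_rel k : T (6 + k) := \sum_(t <- sixth_words) tword (6 + k) (t ++ cyc k).

Lemma sixth_relE (V : lmodType H) (f : seq nat -> V) k :
  tev (fun s => f (map code s)) (sixth_rel k) = \sum_(t <- sixth_words) f (t ++ cyc k).
Proof.
rewrite (linear_sum (@tev V _ (6 + k))) big_seq [RHS]big_seq.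
apply: eq_bigr => t /(allP sixth_letters) t6.
have /letters_word[w ->] : letters (6 + k) (t ++ cyc k).
  move: t6 (cyc_letters k); rewrite /letters size_cat all_cat.
  by move=> /andP[/eqP-> ->] /andP[/eqP-> ->]; rewrite eqxx.
by rewrite -tbasis_tword [LHS]tev_tbasis.
Qed.

Lemma nform_sixth k : nform (sixth_rel k) = 0.
Proof.
rewrite /nform (sixth_relE (nfvec H)).
have e t : nfvec H (t ++ cyc k) =
    nfvec H (cyc k) *m foldr (fun a N => N *m gmx H nwords (lmul a)) 1%:M t.
  by rewrite /nfvec foldr_cat foldr_mulmx.
(* The common factor [cyc k] is split off, leaving the matrix of left multiplication by w. *)
rewrite (eq_bigr _ (fun t _ => e t)) -mulmx_sumr.
rewrite (_ : \sum_(t <- _) _ = 0) ?mulmx0 //.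
apply: (eq_mx_bvec nwords_uniq) => s sN; rewrite mulmx0 mulmx_sumr.
have := feval_eq (bvec H nwords) (sixth_relation sN).
rewrite feval_flatten feval_nil => {2}<-; rewrite big_seq [RHS]big_seq.
apply: eq_bigr => t /(allP sixth_letters)/andP[_ t4]; rewrite -foldr_mulmx.
have [a v /(allP t4) a4 vN||_ ->] := feval_chain H nwords_uniq (f := lmul) (t := t)
  (p := [:: (1%R, s)]).
- exact: lmul_in.
- by rewrite /= andbT.
by rewrite feval1 mulr1z.
Qed.

Lemma state_sixth k :
  tev (fun s => state_vec (map code s)) (sixth_rel k) = sv (false, k %% 3)%N.
Proof.
have k3 := ltn_pmod k (isT : 0 < 3)%N.
have kS : (false, k %% 3)%N \in states by rewrite !inE; case: (k %% 3)%N k3 => [|[|[|]]].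
rewrite sixth_relE; have := feval_eq sv (sixth_words_state k3).
rewrite feval_flatten feval1 mulr1z => <-; rewrite big_seq [RHS]big_seq.
apply: eq_bigr => t /(allP sixth_letters)/andP[_ t4].
have [a v /(allP t4) a4 vN||_ ->] := feval_chain H states_uniq (f := state_act) (t := t)
  (p := [:: (1%R, (false, k %% 3)%N)]).
- exact: state_act_supp.
- by rewrite /= andbT.
by rewrite feval1 mulr1z /state_vec foldr_cat -/(state_vec _) state_vec_cyc.
Qed.

(** The tensor vanishes in B, hence lies in the kernel, while the representation sends it to a basis
    vector and kills the quadratic ideal. *)
Lemma additional_sixth k : additional_relation (sixth_rel k).
Proof.
split; first by rewrite ker_antisymE; apply/eqP/antisym_nform/nform_sixth.
move=> /tev_state_deg2; rewrite state_sixth.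
have k3 := ltn_pmod k (isT : 0 < 3)%N.
have kS : (false, k %% 3)%N \in states by rewrite !inE; case: (k %% 3)%N k3 => [|[|[|]]].
have [j jE] := in_tnth kS; move/rowP/(_ j); rewrite !mxE jE eqxx.
by move/ffunP/(_ 1%g); rewrite !ffunE => /eqP; rewrite oner_eq0.
Qed.

Lemma additional_relationP m : (exists r : T m, additional_relation r) <-> (6 <= m)%N.
Proof.
split=> [[r [rk r2]]|m6]; last first.
  by rewrite -(subnKC m6); exists (sixth_rel _); apply: additional_sixth.
rewrite ltnNge; apply/negP => m5; apply: r2; apply: low_relations m5 _.
by apply/eqP; rewrite -ker_antisymE.
Qed.

End Derivations.

(** * Cyclic classes with four elements *)

Lemma rack_unique (f : nat -> nat -> nat) :
    (forall a b, a < 4 -> b < 4 -> f a b < 4) ->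
    (forall a, a < 4 -> f a a = a) ->
    (forall a b d, a < 4 -> b < 4 -> d < 4 -> f a b = f a d -> b = d) ->
    (forall a b, a < 4 -> b < 4 -> f a 0 = f b 0 -> a = b) ->
    (forall a b d, a < 4 -> b < 4 -> d < 4 -> f a (f b d) = f (f a b) (f a d)) ->
    f 0 1 = 2 -> f 0 2 = 3 -> f 0 3 = 1 ->
  forall a b, a < 4 -> b < 4 -> f a b = rack a b.
Proof.
move=> f4 faa finj fl fd f01 f02 f03.
have f00 := faa 0 isT; have f11 := faa 1 isT; have f22 := faa 2 isT; have f33 := faa 3 isT.
have r a b : a < 4 -> b < 4 -> f 0 (f a b) = f (f 0 a) (f 0 b) by move=> *; apply: fd.
have r10 := r 1 0 isT isT; have r20 := r 2 0 isT isT.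
have r12 := r 1 2 isT isT; have r23 := r 2 3 isT isT.
have r13 := r 1 3 isT isT; have r21 := r 2 1 isT isT.
have d1 := fd 1 0 2 isT isT isT; have d2 := fd 1 2 1 isT isT isT; have d3 := fd 1 3 1 isT isT isT.
have n01 : f 0 0 <> f 1 0 by move=> /(@fl 0 1 isT isT).
have n a b : a < 4 -> b < 4 -> a != b -> f 1 a <> f 1 b.
  by move=> a4 b4 /eqP ab /(@finj 1 a b isT a4 b4).
have n10 := n 0 1 isT isT isT; have n12 := n 1 2 isT isT isT; have n13 := n 1 3 isT isT isT.
have n02 := n 0 2 isT isT isT; have n03 := n 0 3 isT isT isT; have n23 := n 2 3 isT isT isT.
(* Row 1 is a permutation fixing 1, and [f 1 0] is nonzero because column 0 is injective;
   distributivity leaves one candidate. *)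
have [e10 [e12 e13]] : f 1 0 = 3 /\ f 1 2 = 0 /\ f 1 3 = 2.
{ move: (f4 1 0 isT isT) (f4 1 2 isT isT) (f4 1 3 isT isT).
  clear f4 faa finj fl fd r n.
  case E10: (f 1 0) => [|[|[|[|?]]]] // _; case E12: (f 1 2) => [|[|[|[|?]]]] // _;
    case E13: (f 1 3) => [|[|[|[|?]]]] // _; first [by [] | exfalso; congruence]. }
(* Translation by 0 is an automorphism permuting 1, 2, 3 cyclically, so it carries row 1 to row 2
   and row 2 to row 3. *)
have e : [/\ f 2 0 = 1, f 3 0 = 2, f 2 3 = 0, f 3 1 = 0 & f 2 1 = 3] by split; congruence.
case: e => e20 e30 e23 e31 e21; have f32 : f 3 2 = 1 by congruence.
case=> [|[|[|[|a]]]] [|[|[|[|b]]]] // _ _; assumption.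
Qed.

Section Classification.
Local Open Scope group_scope.
Variables (G : finGroupType) (c : G).

Lemma ad_id (a : class_elt c) : ad a a = a.
Proof. by apply: val_inj; rewrite /= /Ad mulgK. Qed.

Lemma adD (a b d : class_elt c) : ad a (ad b d) = ad (ad a b) (ad a d).
Proof. by apply: val_inj; rewrite /= /Ad !invMg invgK !mulgA !mulgKV. Qed.

(** The distinguished element t gets the code 0 and the others 1, 2, 3 in the order of the cycle of
    Ad_t; [rack_unique] then determines the whole table. *)
Lemma cyclic_class_code : cyclic_class (conj_class c) -> #|conj_class c| = 4 ->
  exists code : class_elt c -> nat,
    [/\ injective code, forall a, (code a < 4)%N,
        forall n, (n < 4)%N -> exists a, code a = n &
        forall a b, code (ad a b) = rack (code a) (code b)].
Proof.
move=> [_ [t tC [[s /andP[sc us] sE] [tinj _]]]] C4.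
have: size s = 3.
  have := cardsD1 t (conj_class c); rewrite tC C4 add1n => -[->].
  by rewrite (eq_card (fun g => esym (sE g))); apply/esym/card_uniqP.
case: s us sc sE => [|x [|y [|z []]]] //= us /and4P[/eqP xy /eqP yz /eqP zx _] sE _.
have sC g : g \in [:: x; y; z] -> g \in conj_class c by rewrite sE => /setD1P[].
have [xC yC zC] : [/\ x \in conj_class c, y \in conj_class c & z \in conj_class c].
  by split; apply: sC; rewrite !inE eqxx ?orbT.
pose e : seq (class_elt c) := [:: Sub t tC; Sub x xC; Sub y yC; Sub z zC].
have ue : uniq e.
  rewrite -(map_inj_uniq val_inj) /= us andbT; apply/negP.
  by rewrite sE !inE eqxx.
have eT a : a \in e.
  rewrite -(mem_map val_inj) /= inE sE !inE; case: eqP => //= _.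
  exact: valP.
pose dec n := nth (Sub t tC) e n.
have codeK : cancel (index^~ e) dec by move=> a; rewrite /dec nth_index.
have decK n : n < 4 -> index (dec n) e = n by move=> n4; rewrite index_uniq.
have code_lt a : index a e < 4 by rewrite -[4]/(size e) index_mem.
exists (index^~ e); split=> // [|n n4|a b]; first exact: can_inj codeK.
  by exists (dec n); apply: decK.
pose f i j := index (ad (dec i) (dec j)) e.
rewrite -[ad a b in LHS]/(ad _ _) -{1}(codeK a) -{1}(codeK b) -/(f _ _).
apply: rack_unique => //.
- by move=> i j _ _; apply: code_lt.
- by move=> i i4; rewrite /f ad_id decK.
- move=> i j k i4 j4 k4 /(can_inj codeK) /ad_inj /(congr1 (index^~ e)).
  by rewrite !decK.
- move=> i j i4 j4 /(can_inj codeK) /(congr1 val) /tinj.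
  move=> /(_ (valP _) (valP _)) /val_inj /(congr1 (index^~ e)).
  by rewrite !decK.
- by move=> i j k i4 j4 k4; rewrite /f !codeK adD.
- by rewrite -[RHS]decK // /f; congr (index _ e); apply: val_inj.
- by rewrite -[RHS]decK // /f; congr (index _ e); apply: val_inj.
- by rewrite -[RHS]decK // /f; congr (index _ e); apply: val_inj.
Qed.
End Classification.

Theorem proposition3p3 (R : realType) (G : finGroupType) (c : G)
    (hcyclic : cyclic_class (conj_class c)) (hcard : #|conj_class c| = 4) :
  (forall m : nat, m <= 9 ->
     free_of_rank (Omega R[i] c m) (nth 0 [:: 1; 4; 8; 11; 12; 12; 11; 8; 4; 1] m)) /\
  (forall m : nat, 9 < m -> forall w : Omega R[i] c m, w = 0%R) /\
  ~ quadratic R[i] c /\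
  (forall m : nat, (exists r : tpow R[i] c m, additional_relation r) <-> 6 <= m).
Proof.
have [code [code_inj code_lt code_surj code_ad]] := cyclic_class_code hcyclic hcard.
have charC : [pchar R[i]]%R =i pred0 := @Num.Theory.pchar_num R[i].
have rel := additional_relationP code_inj code_lt code_surj code_ad charC.
split=> [m m9|].
  rewrite -count_nwords //.
  exact: Omega_free code_inj code_lt code_surj code_ad charC m.
split=> [m m9 w|].
  exact: Omega_top code_inj code_lt code_surj code_ad charC m w m9.
split=> // quad; have [r [rk r2]] := (rel 6).2 isT.
exact/r2/quad.
Qed.
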